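(* The infimum of the possible areas of shapes which cover all paths of length $1$ in the plane, $$\alpha=\inf\{m(A):A\subset\mathbb{R}^2\text{ compact},\ \mathrm{esc}(A,\partial A,1)\le 0\},$$ is a right c.e. real number.
   Context: $m$ is Lebesgue measure on $\mathbb{R}^2$. For $L\ge 0$, $P^L$ is the set of equivalence classes $[f]$ of $L$-Lipschitz maps $f:[0,1]\to\mathbb{R}^2$ up to reparameterization, rotation and translation (paths of length $\le L$). For (nonempty) compact $A\subset\mathbb{R}^2$, $\mathrm{dist}^+(A,\partial A,x)=\mathrm{dist}(x,\partial A)$ if $x\notin A$, and $=-\mathrm{dist}(x,\partial A)$ if $x\in A$. With $\mathrm{Isom}^+(\mathbb{R}^2)$ the group of orientation preserving isometries, $$\mathrm{con}(A,\partial A,f)=\max_{t\in[0,1]}\mathrm{dist}^+(A,\partial A,f(t)),\quad \mathrm{wcc}(A,\partial A,[f])=\min_{\sigma\in\mathrm{Isom}^+(\mathbb{R}^2)}\mathrm{con}(A,\partial A,\sigma\circ f),$$ $$\mathrm{esc}(A,\partial A,L)=\max_{[f]\in P^L}\mathrm{wcc}(A,\partial A,[f]).$$ Thus $\mathrm{esc}(A,\partial A,1)\le 0$ says that every path of length at most $1$ can be placed, by a rotation and translation, inside $A$. A real number is right c.e. if the set of rationals greater than it is computably enumerable (equivalently, it is the limit of a computable decreasing sequence of rationals). *)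

(* Defs.v *)
From mathcomp Require Import all_boot all_order all_algebra.
From mathcomp Require Import all_classical all_reals all_analysis.

Set Implicit Arguments.
Unset Strict Implicit.
Unset Printing Implicit Defensive.

Import Order.TTheory GRing.Theory Num.Theory.
Import numFieldNormedType.Exports.

Local Open Scope classical_set_scope.
Local Open Scope ring_scope.

(* Syntax of Kleene's partial recursive functions on natural numbers *)
Inductive recfun : nat -> Type :=
| RZero n : recfun n
| RSucc : recfun 1
| RProj n (i : 'I_n) : recfun n
| RComp n m (g : recfun m) (h : 'I_m -> recfun n) : recfun n
| RPrec n (g : recfun n) (h : recfun n.+2) : recfun n.+1
| RMin n (g : recfun n.+1) : recfun n.

(* [reval p v y]: the partial function denoted by [p] is defined at [v], with
   value [y].  [RPrec g h] recurses on its first argument [k], and [h] receives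
   [k], the previous value and the parameters, in this order.  [RMin g]
   searches for the least first argument at which [g] vanishes, all the
   preceding values of [g] being defined. *)
Fixpoint reval n (p : recfun n) : n.-tuple nat -> nat -> Prop :=
  match p in recfun n return n.-tuple nat -> nat -> Prop with
  | RZero _ => fun _ y => y = 0%N
  | RSucc => fun v y => y = (thead v).+1
  | RProj _ i => fun v y => y = tnth v i
  | RComp _ m g h => fun v y => exists w : m.-tuple nat,
      (forall i, reval (h i) v (tnth w i)) /\ reval g w y
  | RPrec n g h => fun v y =>
      let u : n.-tuple nat := behead_tuple v in
      (fix rec (k : nat) (y : nat) : Prop :=
         match k with
         | 0%N => reval g u y
         | k'.+1 => exists z, rec k' z /\ reval h [tuple of k' :: z :: u] y
         end) (thead v) y
  | RMin _ g => fun v y => reval g [tuple of y :: v] 0%N /\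
      forall i, (i < y)%N -> exists z, reval g [tuple of i :: v] z.+1
  end.

(* Computably enumerable sets as domains of partial recursive functions *)
Definition comp_enumerable n (S : set (n.-tuple nat)) : Prop :=
  exists p : recfun n, forall v, S v <-> exists y, reval p v y.

(* A standard effective numbering: rationals are enumerated (with repetitions)
   by triples of naturals. *)
Definition rat_of_code (v : 3.-tuple nat) : rat :=
  ((tnth v 0)%:R - (tnth v 1)%:R) / (tnth v 2%:R).+1%:R.

Definition rat_comp_enumerable (S : set rat) : Prop :=
  comp_enumerable (rat_of_code @^-1` S).

Definition right_ce (R : realType) (x : R) : Prop :=
  rat_comp_enumerable [set q : rat | x < ratr q].

Section Plane.
Variable R : realType.
Implicit Types (p q x : R * R) (A D : set (R * R)) (s : R * R -> R * R)
  (f : R -> R * R).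

Definition area A : \bar R :=
  ((@lebesgue_measure R) \x (@lebesgue_measure R))%E A.

(* The library's norm on [R * R] is the max norm: it induces the right
   topology, but not the Euclidean distance. *)
Definition dist2 p q : R :=
  Num.sqrt ((p.1 - q.1) ^+ 2 + (p.2 - q.2) ^+ 2).

Definition dist_set x D : R := inf [set dist2 x y | y in D].

Definition boundary A : set (R * R) := closure A `\` A°.

Definition sdist A D x : R :=
  if x \in A then - dist_set x D else dist_set x D.

(* Twice the signed area of the triangle p q x *)
Definition orient p q x : R :=
  (q.1 - p.1) * (x.2 - p.2) - (q.2 - p.2) * (x.1 - p.1).

Definition Isomp : set (R * R -> R * R) :=
  [set s | (forall p q, dist2 (s p) (s q) = dist2 p q) /\
           (forall p q x, 0 < orient p q x -> 0 < orient (s p) (s q) (s x))].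

(* Only the values of [f] on [0, 1] are ever used. *)
Definition lip_path (L : R) : set (R -> R * R) :=
  [set f | {in `[0, 1] &, forall t u, dist2 (f t) (f u) <= L * `|t - u|}].

(* For A compact and nonempty, D = boundary A and f continuous on [0, 1], the
   sets below are nonempty and bounded (on the relevant side) and the suprema
   and infima are attained. *)
Definition con A D f : R := sup [set sdist A D (f t) | t in `[0, 1]].

Definition wcc A D f : R := inf [set con A D (s \o f) | s in Isomp].

(* [wcc] is invariant under reparameterization, rotation and translation of
   [f], so this is the supremum over the equivalence classes of paths. *)
Definition esc A D (L : R) : R := sup [set wcc A D f | f in lip_path L].

End Plane.

(* Main.v *)
Require Import Defs.
From mathcomp Require Import all_boot all_order all_algebra.
From mathcomp Require Import all_classical all_reals all_analysis.
From mathcomp Require Import ring lra.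
Import Order.TTheory GRing.Theory Num.Theory.
Import numFieldNormedType.Exports.
Local Open Scope classical_set_scope.
Local Open Scope ring_scope.

(** A number [q] exceeds the infimum iff there is a finite certificate,
    checkable by bounded arithmetic: an integer [N > 0] and a finite union [S] of square
    cells of side [(N + 2) / N ^ 2], of total area [< q], such that every chain
    of [N + 1] points of the grid of mesh [1 / N ^ 2] with steps of length at
    most [(N + 2) / N ^ 2] has an image by a rotation with rational sine and
    cosine and a grid translation for which the 3 x 3 block of cells around each
    point lies in [S].  Such an [S] covers every path, because a path of length 1
    rounds to a chain and stays within one cell side of it.  Conversely, if a
    compact [A] of area [< q] covers all paths, then some neighbourhood of [A]
    still has area [< q]; take [N] large and let [S] consist of the cells inside
    this neighbourhood.  Chains are traced, up to [O(1 / N)], by 1-Lipschitz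
    polygons, which fit in [A]; approximate the rotation by a rational one. *)

Set Implicit Arguments.
Unset Strict Implicit.
Unset Printing Implicit Defensive.

(** * Computable functions *)

Section Computability.
Local Open Scope nat_scope.

(* [f] acts on environments of any length, a missing argument being read as
   [0]; bound variables are pushed in front of the environment. *)
Definition computable (f : seq nat -> nat) : Prop :=
  forall n, exists p : recfun n, forall (v : n.-tuple nat) y,
    reval p v y <-> y = f v.

Lemma eq_computable f g : f =1 g -> computable f -> computable g.
Proof.
by move=> fg cf n; have [p hp] := cf n; exists p => v y; rewrite -fg; exact: hp.
Qed.

(** Out of range, [nth] falls back on the constant 0, so the second hypothesis can range over all
    [i]. *)
Lemma computable_comp (g : seq nat -> nat) (hs : seq (seq nat -> nat)) :
  computable g -> (forall i, computable (nth (fun=> 0) hs i)) ->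
  computable (fun e => g [seq h e | h <- hs]).
Proof.
move=> cg chs n; have [p hp] := cg (size hs).
have /choice[q hq] : forall i : 'I_(size hs), exists q : recfun n,
    forall (v : n.-tuple nat) y, reval q v y <-> y = nth (fun=> 0) hs i v.
  by move=> i; apply: chs.
exists (RComp p q) => v y /=; split => [[w [hw /hp->]]|->].
  congr g; apply: (@eq_from_nth _ 0); rewrite size_tuple ?size_map// => i ilt.
  rewrite (nth_map (fun=> 0))//; have /hq/= := hw (Ordinal ilt).
  by rewrite (tnth_nth 0).
exists (map_tuple (fun h => h (v : seq nat)) (in_tuple hs)); split.
  by move=> i; apply/hq; rewrite tnth_map (tnth_nth (fun=> 0)).
by apply/hp.
Qed.

Lemma computable_nth i : computable (fun e => nth 0 e i).
Proof.
move=> n; have [ilt|ige] := ltnP i n.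
  by exists (RProj (Ordinal ilt)) => v y /=; rewrite (tnth_nth 0).
by exists (RZero n) => v y /=; rewrite nth_default ?size_tuple.
Qed.

Lemma computable_succ : computable (fun e => (nth 0 e 0).+1).
Proof.
(* In arity 0 there is no argument to project; the missing one reads as 0. *)
move=> n; exists (RComp RSucc (fun=> match n with
  | 0 => RZero 0 | n'.+1 => RProj ord0 end)) => v y /=.
have H z : reval (match n as n return recfun n with
    0 => RZero 0 | n'.+1 => RProj ord0 end) v z <-> z = nth 0 v 0.
  by case: n v => [|n] v /=; rewrite ?tuple0// (tnth_nth 0).
split => [[w [hw ->]]|->].
  by have /H := hw ord0; rewrite /thead => ->.
exists [tuple nth 0 v 0]; split=> [i|//]; rewrite ord1; exact/H.
Qed.

(** Selecting positions is a composition with projections. The selection [r] depends on the arity,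
    as a short environment lacks some positions. *)
Lemma computable_reindex (t : seq nat -> seq nat) f :
  (forall n, exists r : seq 'I_n,
    forall v : n.-tuple nat, t v = [seq tnth v i | i <- r]) ->
  computable f -> computable (fun e => f (t e)).
Proof.
move=> ht cf n; have [r hr] := ht n; have [p hp] := cf (size r).
exists (RComp p (fun i => RProj (tnth (in_tuple r) i))) => v y /=.
have -> : t v = map_tuple (tnth v) (in_tuple r) by rewrite hr.
split=> [[w [hw /hp->]]|->].
  congr (f (val _)); apply: eq_from_tnth => i.
  by rewrite hw tnth_map.
exists (map_tuple (tnth v) (in_tuple r)); split; last exact/hp.
by move=> i; rewrite tnth_map.
Qed.

(** [RPrec] recurses on a count at the head of the environment; a composition then puts [k e]
    there. *)
Lemma computable_iteri a b k :
  computable a ->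
  computable (fun e => b (nth 0 e 0) (nth 0 e 1) (behead (behead e))) ->
  computable k ->
  computable (fun e => iteri (k e) (fun i z => b i z e) (a e)).
Proof.
move=> ca cb ck.
pose r (e : seq nat) :=
  iteri (head 0 e) (fun i z => b i z (behead e)) (a (behead e)).
suff cr n : exists p : recfun n.+1, forall (v : n.+1.-tuple nat) y,
    reval p v y <-> y = r v.
  move=> n; have [p hp] := cr n; have [q hq] := ck n.
  exists (RComp p (fun i => if unlift ord0 i is Some j then RProj j else q)).
  move=> v y /=; split.
    move=> [w [hw /hp->]].
    have -> : w = [tuple of k v :: v] :> seq nat; last by [].
    congr val; apply: eq_from_tnth => i.
    case: (unliftP ord0 i) (hw i) => [j ->|->] /=.
      by rewrite tnthS.
    by move=> /hq ->; rewrite tnth0.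
  move=> ->; exists [tuple of k v :: v]; split; last exact/hp.
  move=> i; case: (unliftP ord0 i) => [j ->|->] /=.
    by rewrite tnthS.
  by rewrite tnth0; apply/hq.
have [p hp] := ca n; have [q hq] := cb n.+2.
exists (RPrec p q) => v y; rewrite /= /r.
have -> : head 0 v = thead v by rewrite (tuple_eta v).
elim: (thead v) y => [|i ih] y /=; first by rewrite hp.
split=> [[z [/ih-> /hq->]]//|->].
by exists (iteri i (fun i z => b i z (behead v)) (a (behead v))); split;
  [exact/ih|exact/hq].
Qed.
(** Under binders the outer environment appears as an iterated [behead]; this notion lets [comp_var]
    treat every depth at once. *)
Definition tail_map (t : seq nat -> seq nat) : Prop :=
  exists k, forall e, t e = drop k e.

Lemma tail_map_id : tail_map (fun e => e).
Proof. by exists 0 => e; rewrite drop0. Qed.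

Lemma tail_map_behead t : tail_map t -> tail_map (fun e => behead (t e)).
Proof. by case=> k tk; exists k.+1 => e; rewrite tk -drop1 drop_drop. Qed.

Lemma computable_var t i : tail_map t -> computable (fun e => nth 0 (t e) i).
Proof.
case=> k tk; apply: eq_computable (computable_nth (k + i)) => e.
by rewrite tk nth_drop.
Qed.

Lemma computable_app1 (F : nat -> nat) f :
  computable (fun e => F (nth 0 e 0)) -> computable f ->
  computable (fun e => F (f e)).
Proof.
move=> cF cf; apply: (computable_comp (hs := [:: f]) cF) => -[//|i].
by rewrite /= nth_nil => n; exists (RZero n).
Qed.

Lemma computable_app2 (F : nat -> nat -> nat) f g :
  computable (fun e => F (nth 0 e 0) (nth 0 e 1)) ->
  computable f -> computable g -> computable (fun e => F (f e) (g e)).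
Proof.
move=> cF cf cg; apply: (computable_comp (hs := [:: f; g]) cF) => -[//|[//|i]].
by rewrite /= nth_nil => n; exists (RZero n).
Qed.

Lemma computable_cst c : computable (fun=> c).
Proof.
elim: c => [|c ih]; first by move=> n; exists (RZero n).
exact: (computable_app1 (F := succn) computable_succ).
Qed.

Ltac comp_var := solve [apply: computable_var;
  repeat (exact: tail_map_id || apply: tail_map_behead)].

Lemma computableS f : computable f -> computable (fun e => (f e).+1).
Proof. exact: (computable_app1 (F := succn) computable_succ). Qed.

Lemma computableD f g :
  computable f -> computable g -> computable (fun e => f e + g e).
Proof.
apply: computable_app2.
apply: (@eq_computable (fun e =>
    iteri (nth 0 e 1) (fun i z => z.+1) (nth 0 e 0))).
  by move=> e; elim: (nth 0 e 1) => [|n ih] /=; rewrite ?addn0 ?addnS ?ih.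
apply: (computable_iteri (b := fun i z e => z.+1)); try comp_var.
by apply: computableS; comp_var.
Qed.

Lemma computable_predn f : computable f -> computable (fun e => (f e).-1).
Proof.
apply: computable_app1.
apply: (@eq_computable (fun e => iteri (nth 0 e 0) (fun i z => i) 0)).
  by move=> e; case: (nth 0 e 0).
by apply: (computable_iteri (b := fun i z e => i)); try comp_var;
  exact: computable_cst.
Qed.

Lemma computableB f g :
  computable f -> computable g -> computable (fun e => f e - g e).
Proof.
apply: computable_app2.
apply: (@eq_computable (fun e =>
    iteri (nth 0 e 1) (fun i z => z.-1) (nth 0 e 0))).
  by move=> e; elim: (nth 0 e 1) => [|n ih] /=; rewrite ?subn0 ?subnS ?ih.
apply: (computable_iteri (b := fun i z e => z.-1)); try comp_var.
by apply: computable_predn; comp_var.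
Qed.

Lemma computable_sum b f :
  computable b -> computable (fun e => f (nth 0 e 0) (behead e)) ->
  computable (fun e => \sum_(0 <= i < b e) f i e).
Proof.
move=> cb cf.
apply: (@eq_computable (fun e => iteri (b e) (fun i z => z + f i e) 0)).
  move=> e; elim: (b e) => [|n ih] /=; first by rewrite big_nil.
  by rewrite big_nat_recr//= ih.
apply: (computable_iteri (b := fun i z e => z + f i e)) => //.
  exact: computable_cst.
apply: computableD; first by comp_var.
(* The loop body sees the index, the accumulator and then the environment, whereas [f] expects no
   accumulator: position 1 is deleted. *)
apply: (@eq_computable (fun e =>
    (fun e' => f (nth 0 e' 0) (behead e')) (take 1 e ++ drop 2 e))).
  by case=> [|x [|y e]] /=; rewrite ?drop0.
apply: computable_reindex cf => n.
exists (take 1 (enum 'I_n) ++ drop 2 (enum 'I_n)).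
by move=> v; rewrite map_cat map_take map_drop map_tnth_enum.
Qed.

Lemma computableM f g :
  computable f -> computable g -> computable (fun e => f e * g e).
Proof.
apply: computable_app2.
apply: (@eq_computable (fun e => \sum_(0 <= i < nth 0 e 0) nth 0 e 1)).
  by move=> e; rewrite sum_nat_const_nat subn0.
by apply: (computable_sum (f := fun i e => nth 0 e 1)); comp_var.
Qed.

Lemma computableX f g :
  computable f -> computable g -> computable (fun e => f e ^ g e).
Proof.
apply: computable_app2.
apply: (@eq_computable (fun e =>
    iteri (nth 0 e 1) (fun i z => nth 0 e 0 * z) 1)).
  by move=> e; elim: (nth 0 e 1) => [|n ih] /=; rewrite ?expn0 ?expnS ?ih.
apply: (computable_iteri (b := fun i z e => nth 0 e 0 * z)); try comp_var.
  exact: computable_cst.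
by apply: computableM; comp_var.
Qed.

(** Any positive value means true, so that conjunction is a product and bounded existence a sum. *)
Definition decidable_rel (P : seq nat -> Prop) : Prop :=
  exists2 c, computable c & forall e, P e <-> 0 < c e.

Lemma decidable_leq f g :
  computable f -> computable g -> decidable_rel (fun e => f e <= g e).
Proof.
move=> cf cg; exists (fun e => (g e).+1 - f e) => [|e].
  by apply: computableB => //; apply: computableS.
by rewrite subn_gt0 ltnS.
Qed.

Lemma decidable_and P Q :
  decidable_rel P -> decidable_rel Q -> decidable_rel (fun e => P e /\ Q e).
Proof.
move=> [c cc hc] [d cd hd]; exists (fun e => c e * d e).
  exact: computableM.
by move=> e; rewrite hc hd muln_gt0; split=> [[-> ->]|/andP].
Qed.

Lemma decidable_imp P Q :
  decidable_rel P -> decidable_rel Q -> decidable_rel (fun e => P e -> Q e).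
Proof.
move=> [c cc hc] [d cd hd]; exists (fun e => (1 - c e) + d e).
  by apply: computableD => //; apply: computableB => //; exact: computable_cst.
move=> e; rewrite hc hd; rewrite addn_gt0 subn_gt0 ltnS leqn0.
by case: (c e) => [|n] /=; split=> // h; exact: h.
Qed.

Lemma decidable_eq f g :
  computable f -> computable g -> decidable_rel (fun e => f e = g e).
Proof.
move=> cf cg; have [c cc hc] := decidable_and (decidable_leq cf cg)
  (decidable_leq cg cf); exists c => // e.
by rewrite -hc; split=> [->//|/andP]; rewrite -eqn_leq => /eqP.
Qed.

Lemma decidable_ex b P :
  computable b -> decidable_rel (fun e => P (nth 0 e 0) (behead e)) ->
  decidable_rel (fun e => exists2 i, i < b e & P i e).
Proof.
move=> cb [c cc hc].
have hP i e : P i e <-> 0 < c (i :: e) by exact: (hc (i :: e)).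
exists (fun e => \sum_(0 <= i < b e) c (i :: e)).
  apply: (computable_sum cb).
  apply: (@eq_computable (fun e => c (nth 0 e 0 :: behead e))) => //.
  (* The list passed to [c] is the environment itself, except in arity 0, where it is [[:: 0]]. *)
  move=> n; case: n => [|n]; last first.
    have [p hp] := cc n.+1; exists p => v y; rewrite hp.
    by rewrite [in X in X <-> _](tuple_eta v) [in X in _ <-> X](tuple_eta v).
  have [p hp] := computable_cst (c [:: 0]) 0.
  by exists p => v y; rewrite hp tuple0.
move=> e; rewrite lt0n big_mkord sum_nat_eq0 negb_forall; split.
  move=> [i ib /hP ci]; apply/existsP; exists (Ordinal ib).
  by rewrite /= -lt0n.
by move=> /existsP[i]; rewrite /= -lt0n => /hP Pi; exists i.
Qed.

Lemma decidable_not P : decidable_rel P -> decidable_rel (fun e => ~ P e).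
Proof.
move=> [c cc hc]; exists (fun e => 1 - c e).
  by apply: computableB => //; exact: computable_cst.
by move=> e; rewrite hc subn_gt0 ltnS leqn0; case: (c e) => [|n]; split.
Qed.

Lemma decidable_all b P :
  computable b -> decidable_rel (fun e => P (nth 0 e 0) (behead e)) ->
  decidable_rel (fun e => forall i, i < b e -> P i e).
Proof.
move=> cb dP; have [c cc hc] := decidable_not
  (decidable_ex (P := fun i e => ~ P i e) cb (decidable_not dP)).
exists c => // e; rewrite -hc; split=> [bP [i ib]|nP i ib].
  by apply; exact: bP.
by apply: contrapT => nPi; apply: nP; exists i.
Qed.

(* [1 - (1 - c)] turns a positive number into [1]. *)
Lemma computable_ind P (b : seq nat -> bool) :
  decidable_rel P -> (forall e, P e <-> b e) -> computable (fun e => b e).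
Proof.
move=> [c cc hc] hb.
apply: (@eq_computable (fun e => 1 - (1 - c e))); last first.
  by do 2![apply: computableB; first exact: computable_cst].
move=> e; have := hc e; rewrite hb.
case: (c e) (b e) => [|n] [] [h1 h2]; rewrite ?subSS ?sub0n ?subn0 ?subn1//=.
- by have := h1 isT.
- by have := h2 isT.
Qed.

(** The quotient counts the positive multiples of the divisor up to the dividend; the test
    [0 < nth 0 e 1] reproduces division by zero yielding 0. *)
Lemma computable_divn f g :
  computable f -> computable g -> computable (fun e => f e %/ g e).
Proof.
apply: computable_app2.
apply: (@eq_computable (fun e => \sum_(0 <= i < nth 0 e 0)
   (0 < nth 0 e 1) && (i.+1 * nth 0 e 1 <= nth 0 e 0))).
  move=> e; set m := nth 0 e 0; set d := nth 0 e 1.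
  case: (posnP d) => [->|d0] /=; first by rewrite divn0 big1.
  have mle : m %/ d <= m by exact: leq_div.
  rewrite (@big_cat_nat _ _ _ (m %/ d))//= -[RHS]addn0; congr (_ + _).
    rewrite -[RHS]muln1 -[X in X * _]subn0 -sum_nat_const_nat.
    by apply: eq_big_nat => i /andP[_ im]; rewrite -leq_divRL// im.
  rewrite big_nat big1// => i /andP[im _].
  by rewrite -leq_divRL// ltnNge im.
apply: (computable_sum (f := fun i e =>
  (0 < nth 0 e 1) && (i.+1 * nth 0 e 1 <= nth 0 e 0))); first by comp_var.
apply: (computable_ind (P := fun e => (0 < nth 0 (behead e) 1) /\
   ((nth 0 e 0).+1 * nth 0 (behead e) 1 <= nth 0 (behead e) 0))).
  apply: decidable_and; apply: decidable_leq; try comp_var.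
    exact: computable_cst.
  by apply: computableM; [apply: computableS|]; comp_var.
by move=> e; split=> /andP.
Qed.

Lemma computable_modn f g :
  computable f -> computable g -> computable (fun e => f e %% g e).
Proof.
move=> cf cg; apply: (@eq_computable (fun e => f e - f e %/ g e * g e)).
  by move=> e; rewrite {1}(divn_eq (f e) (g e)) addKn.
by apply: computableB => //; apply: computableM => //; exact: computable_divn.
Qed.

(** [RMin] looks for a zero, hence runs on [1 - c]. This function is total, so the search reaches
    the least witness whenever there is one. *)
Lemma enumerable_search (P : nat -> seq nat -> Prop) n :
  decidable_rel (fun e => P (nth 0 e 0) (behead e)) ->
  comp_enumerable [set v : n.-tuple nat | exists m, P m v].
Proof.
move=> [c cc hc].
have [p hp] := computableB (computable_cst 1) cc n.+1.
have hP m (v : n.-tuple nat) : P m v <-> 0 < c (m :: v) by exact: (hc (m :: v)).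
exists (RMin p) => v /=; split=> [exP|[y [/hp/= cy _]]]; last first.
  exists y; apply/hP; rewrite lt0n; apply/eqP => c0.
  by move: cy; rewrite c0.
have exc : exists m, 0 < c (m :: v) by have [m /hP] := exP; exists m.
have cm := ex_minnP exc; exists (ex_minn exc); case: cm => m cm mmin.
split; first by apply/hp => /=; case: (c _) cm.
move=> i im; exists 0; apply/hp => /=.
by case E: (c _) => [//|k];
  have := mmin i; rewrite E => /(_ isT); rewrite leqNgt im.
Qed.

(** * Certificates *)

(** Finite sequences are coded by their base [b] expansions, lowest digit first, so that quantifying
    over bounded sequences is a bounded quantification over numbers. *)
Definition digit b s k := s %/ b ^ k %% b.

Lemma computable_digit f g h : computable f -> computable g -> computable h ->
  computable (fun e => digit (f e) (g e) (h e)).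
Proof.
move=> cf cg ch; apply: computable_modn => //; apply: computable_divn => //.
exact: computableX.
Qed.

Lemma digitsP b n (d : nat -> nat) : (forall k, k < n -> d k < b) ->
  exists2 s, s < b ^ n & forall k, k < n -> digit b s k = d k.
Proof.
elim: n d => [|n ih] d db; first by exists 0.
have [//|s sb sd] := ih (fun k => d k.+1).
  by move=> k kn; exact: db.
have b0 : 0 < b by exact: leq_ltn_trans (leq0n _) (db 0 isT).
exists (s * b + d 0).
  rewrite expnSr (leq_trans (_ : _ < s.+1 * b))//.
    by rewrite mulSn addnC ltn_add2r db.
  by rewrite leq_mul2r sb orbT.
move=> [_|k kn].
  by rewrite /digit expn0 divn1 modnMDl modn_small//; exact: db.
by rewrite -sd// /digit expnS divnMA divnMDl// (divn_small (db 0 isT)) addn0.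
Qed.

Lemma ltn_digit b s k : 0 < b -> digit b s k < b.
Proof. by move=> b0; rewrite /digit ltn_pmod. Qed.

(* Lengths are in units of [1 / N ^ 2], and signed quantities are differences of
   naturals.  A placement rotates by the angle of cosine [(a1 - a2) / c] and
   sine [(b1 - b2) / c], then translates by [(x1 - x2, y1 - y2)]. *)
Definition placement (a1 a2 b1 b2 c : nat) : Prop :=
  0 < c /\ a1 ^ 2 + a2 ^ 2 + b1 ^ 2 + b2 ^ 2 = c ^ 2 + 2 * (a1 * a2 + b1 * b2).

(* [(I + 1) L <= (pos - neg) / c <= (I + 2) L] with denominators cleared: the
   point is in the middle one of the strips [I], [I + 1], [I + 2]. *)
Definition in_strip (L c pos neg I : nat) : Prop :=
  I.+1 * L * c + neg <= pos /\ pos <= I.+2 * L * c + neg.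

(* Bit [i * B + j] of [s] tells whether the cell [(i, j)] belongs to [S]. *)
Definition block_in (B s I J : nat) : Prop :=
  forall i, i < 3 -> forall j, j < 3 ->
    [/\ I + i < B, J + j < B & digit 2 s ((I + i) * B + (J + j)) = 1].

(** The pairs given to [in_strip] are the positive and negative parts of [c] times the two
    coordinates of the image of [(x, y)]. *)
Definition placed (L B s a1 a2 b1 b2 c x1 x2 y1 y2 x y : nat) : Prop :=
  exists2 I, I < B & exists2 J, J < B &
    [/\ in_strip L c (a1 * x + b2 * y + c * x1) (a2 * x + b1 * y + c * x2) I,
        in_strip L c (b1 * x + a1 * y + c * y1) (b2 * x + a2 * y + c * y2) J &
        block_in B s I J].

Definition adiff m n := (m - n) + (n - m).

Definition grid_chain (N : nat) (x y : nat -> nat) : Prop :=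
  forall i, i < N ->
    adiff (x i.+1) (x i) ^ 2 + adiff (y i.+1) (y i) ^ 2 <= (N + 2) ^ 2.

(* [g] lists in base [D] the nine parameters of a placement. *)
Definition chain_fits (N B D s : nat) (x y : nat -> nat) : Prop :=
  exists2 g, g < D ^ 9 &
    placement (digit D g 0) (digit D g 1) (digit D g 2) (digit D g 3)
      (digit D g 4) /\
    forall i, i < N.+1 -> placed (N + 2) B s
      (digit D g 0) (digit D g 1) (digit D g 2) (digit D g 3) (digit D g 4)
      (digit D g 5) (digit D g 6) (digit D g 7) (digit D g 8) (x i) (y i).

(** Coordinates run from 0 to [2 * N ^ 2]: a square of side 2 in the original scale, which contains
    every path of length 1 starting at its centre. *)
Definition grid_size (N : nat) := 2 * N ^ 2 + 1.

(* The digits of [e] are the coordinates of the successive points of a chain. *)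
Definition chain_x N e i := digit (grid_size N) e (2 * i).

Definition chain_y N e i := digit (grid_size N) e (2 * i).+1.

Definition all_chains_fit (N B D s : nat) : Prop :=
  forall e, e < grid_size N ^ (2 * N.+1) ->
    grid_chain N (chain_x N e) (chain_y N e) ->
    chain_fits N B D s (chain_x N e) (chain_y N e).

Definition cell_count B s := \sum_(0 <= k < B ^ 2) digit 2 s k.

(* The rational [q] is [(v0 - v1) / (v2 + 1)]. *)
Definition certificate (v0 v1 v2 N B D s : nat) : Prop :=
  [/\ 0 < N, cell_count B s * (N + 2) ^ 2 * v2.+1 + v1 * N ^ 4 < v0 * N ^ 4
    & all_chains_fit N B D s].

Lemma decidable_and3 P Q S : decidable_rel P -> decidable_rel Q ->
  decidable_rel S -> decidable_rel (fun e => [/\ P e, Q e & S e]).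
Proof.
move=> dP dQ dS; have [c cc hc] := decidable_and dP (decidable_and dQ dS).
by exists c => // e; rewrite -hc; split=> [[]|[? []]].
Qed.

Ltac dec_step := first
  [ comp_var | exact: computable_cst
  | apply: computable_sum | apply: computable_digit | apply: computableX
  | apply: computableM | apply: computableS | apply: computableB
  | apply: computableD | apply: decidable_leq | apply: decidable_eq
  | apply: decidable_and3 | apply: decidable_and | apply: decidable_ex
  | apply: decidable_all | apply: decidable_imp ].

(** All quantifiers inside [certificate] are bounded, so it is decidable; the search runs over a
    common bound [m] for [N], [B], [D] and [s]. *)
Lemma enumerable_certificate : comp_enumerable [set v : 3.-tuple nat |
  exists N B D s,
    certificate (tnth v 0%R) (tnth v 1%R) (tnth v 2%:R%R) N B D s].
Proof.
have [|p hp] := @enumerable_search (fun m e =>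
  exists2 N, N < m & exists2 B, B < m & exists2 D, D < m & exists2 s, s < m &
  certificate (nth 0 e 0) (nth 0 e 1) (nth 0 e 2) N B D s) 3.
  rewrite /certificate /all_chains_fit /cell_count /chain_fits /placement.
  rewrite /placed /block_in /in_strip /grid_chain /adiff.
  rewrite /chain_x /chain_y /grid_size.
  by repeat dec_step.
exists p => v; rewrite -hp /= !(tnth_nth 0) /=; split.
  move=> [N [B [D [s h]]]]; exists (N + B + D + s).+1.
  exists N; first by rewrite ltnS -!addnA leq_addr.
  exists B; first by rewrite ltnS -addnA -addnA addnCA leq_addr.
  exists D; first by rewrite ltnS addnAC leq_addl.
  by exists s; first by rewrite ltnS leq_addl.
by move=> [m [N _ [B _ [D _ [s _ h]]]]]; exists N, B, D, s.
Qed.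

End Computability.

(** * Plane geometry *)

Section Euclid.
Variable R : realType.
Implicit Types (p q v : R * R) (a b c : R).

Definition enorm p : R := Num.sqrt (p.1 ^+ 2 + p.2 ^+ 2).

Lemma dist2E p q : dist2 p q = enorm (p - q).
Proof. by []. Qed.

Lemma enorm_ge0 p : 0 <= enorm p.
Proof. exact: sqrtr_ge0. Qed.

Lemma sqr_enorm p : enorm p ^+ 2 = p.1 ^+ 2 + p.2 ^+ 2.
Proof. by rewrite sqr_sqrtr// addr_ge0 ?sqr_ge0. Qed.

Lemma enorm_le p c : 0 <= c -> (enorm p <= c) = (p.1 ^+ 2 + p.2 ^+ 2 <= c ^+ 2).
Proof. by move=> c0; rewrite -sqr_enorm ler_pXn2r ?nnegrE ?enorm_ge0. Qed.

Lemma enormN p : enorm (- p) = enorm p.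
Proof. by rewrite /enorm /= !sqrrN. Qed.

Lemma ler_enormD p q : enorm (p + q) <= enorm p + enorm q.
Proof.
rewrite enorm_le ?addr_ge0 ?enorm_ge0//= [leRHS]sqrrD !sqr_enorm.
suff : p.1 * q.1 + p.2 * q.2 <= enorm p * enorm q by lra.
apply: le_trans (ler_norm _) _.
rewrite -[leRHS]ger0_norm ?mulr_ge0 ?enorm_ge0//.
rewrite -ler_sqr ?nnegrE// !real_normK ?num_real//.
rewrite exprMn !sqr_enorm.
(* Cauchy-Schwarz, by Lagrange's identity. *)
have := sqr_ge0 (p.1 * q.2 - p.2 * q.1); nra.
Qed.

Lemma ler_enorm1 p : `|p.1| <= enorm p.
Proof.
rewrite -ler_sqr ?nnegrE ?enorm_ge0// sqr_enorm real_normK ?num_real//.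
by rewrite lerDl sqr_ge0.
Qed.

Lemma ler_enorm2 p : `|p.2| <= enorm p.
Proof.
rewrite -ler_sqr ?nnegrE ?enorm_ge0// sqr_enorm real_normK ?num_real//.
by rewrite lerDr sqr_ge0.
Qed.

Lemma enorm_le_sum p : enorm p <= `|p.1| + `|p.2|.
Proof.
rewrite enorm_le ?addr_ge0// [leRHS]sqrrD !real_normK ?num_real//.
have := mulr_ge0 (normr_ge0 p.1) (normr_ge0 p.2); lra.
Qed.

Lemma enormZ c p : enorm (c *: p) = `|c| * enorm p.
Proof. by rewrite /enorm /= !exprMn -mulrDr sqrtrM ?sqr_ge0// sqrtr_sqr. Qed.

Lemma dist2_ge0 p q : 0 <= dist2 p q.
Proof. by rewrite dist2E enorm_ge0. Qed.

Lemma dist2C p q : dist2 p q = dist2 q p.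
Proof. by rewrite !dist2E -enormN opprB. Qed.

Lemma dist2_triangle q p v : dist2 p v <= dist2 p q + dist2 q v.
Proof. by rewrite !dist2E -[p - v](subrKA q) ler_enormD. Qed.

(** Multiplication by the complex number [a + ib]. Its modulus is left free, so that the difference
    of two rotations also has this form. *)
Definition rotation a b p : R * R := (a * p.1 - b * p.2, b * p.1 + a * p.2).

Lemma rotB a b p q : rotation a b (p - q) = rotation a b p - rotation a b q.
Proof. by congr (_, _) => /=; ring. Qed.

Lemma enorm_rot_gen a b p : enorm (rotation a b p) = enorm (a, b) * enorm p.
Proof.
rewrite /enorm -sqrtrM ?addr_ge0 ?sqr_ge0//=; congr Num.sqrt; ring.
Qed.

Lemma enorm_rot a b p : a ^+ 2 + b ^+ 2 = 1 -> enorm (rotation a b p) = enorm p.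
Proof. by move=> ab; rewrite enorm_rot_gen /enorm/= ab sqrtr1 mul1r. Qed.

Lemma rigid_Isomp a b v :
  a ^+ 2 + b ^+ 2 = 1 -> Isomp (fun p => rotation a b p + v).
Proof.
move=> ab; split=> [p q|p q x].
  rewrite !dist2E -(enorm_rot (p - q) ab) rotB; congr enorm.
  by rewrite opprD addrACA subrr addr0.
rewrite /orient /=; congr (_ < _).
rewrite -[LHS]mul1r -ab; ring.
Qed.

(** The images of the origin and of the two unit vectors determine [s]: they form an orthonormal
    frame, positively oriented, and the distances to its three points give the coordinates of any
    image. *)
Lemma Isomp_rigid s : Isomp s -> exists a b v,
  a ^+ 2 + b ^+ 2 = 1 /\ forall p, s p = rotation a b p + v.
Proof.
move=> [ds os].
have dsE p q : ((s p).1 - (s q).1) ^+ 2 + ((s p).2 - (s q).2) ^+ 2 =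
               (p.1 - q.1) ^+ 2 + (p.2 - q.2) ^+ 2.
  have := ds p q; rewrite !dist2E => /(congr1 (fun x => x ^+ 2)).
  by rewrite !sqr_enorm.
have o1 : 0 < orient (0, 0) (1, 0) (0, 1) :> R by rewrite /orient /=; lra.
have {os} := os _ _ _ o1; rewrite /orient.
have e01 := dsE (1, 0) (0, 0); have e02 := dsE (0, 1) (0, 0).
have e12 := dsE (1, 0) (0, 1).
set o := s (0, 0) in e01 e02 *; set u := s (1, 0) in e01 e12 *.
set w := s (0, 1) in e02 e12 *.
move: e01 e02 e12; rewrite /= !(subr0, sub0r, sqrrN, expr1n, expr0n).
rewrite !(addr0, add0r)/=.
move=> e01 e02 e12 o2.
have e0 p := dsE p (0, 0); have e1 p := dsE p (1, 0).
have e2 p := dsE p (0, 1).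
exists (u.1 - o.1), (u.2 - o.2), o; split=> // p.
move: (e0 p) (e1 p) (e2 p); rewrite -/u -/o -/w /=.
clear e0 e1 e2 dsE ds o1; case: (s p) o u w e01 e02 e12 o2.
move=> z1 z2 [m1 m2] [u1 u2] [w1 w2] /=.
rewrite !subr0 => e01 e02 e12 o2 e0 e1 e2.
have -> : z1 = z1 - m1 + m1 by rewrite subrK.
have -> : z2 = z2 - m2 + m2 by rewrite subrK.
have E1 : z1 - u1 = (z1 - m1) - (u1 - m1) by ring.
have E2 : z2 - u2 = (z2 - m2) - (u2 - m2) by ring.
have E3 : z1 - w1 = (z1 - m1) - (w1 - m1) by ring.
have E4 : z2 - w2 = (z2 - m2) - (w2 - m2) by ring.
have E5 : u1 - w1 = (u1 - m1) - (w1 - m1) by ring.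
have E6 : u2 - w2 = (u2 - m2) - (w2 - m2) by ring.
rewrite {}E1 {}E2 in e1; rewrite {}E3 {}E4 in e2; rewrite {}E5 {}E6 in e12.
move: o2 e01 e02 e0 e1 e2 e12.
move: (z1 - m1) (z2 - m2) (u1 - m1) (u2 - m2) (w1 - m1) (w2 - m2).
move=> {z1 z2 u1 u2 w1 w2} z1 z2 a b c d o2 e01 e02 e0 e1 e2 e12.
have dot0 : a * c + b * d = 0 by lra.
have det1 : a * d - b * c = 1.
  (* By Lagrange's identity the determinant has square 1; the orientation [o2] excludes -1. *)
  have : (a * d - b * c - 1) * (a * d - b * c + 1) = 0.
    transitivity ((a ^+ 2 + b ^+ 2) * (c ^+ 2 + d ^+ 2) -
      (a * c + b * d) ^+ 2 - 1); first by ring.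
    by rewrite e01 e02 dot0; ring.
  move=> /eqP; rewrite mulf_eq0 => /orP[/eqP|/eqP]; lra.
(* The expansion is the sum of the two squared lengths minus twice the determinant: 1 + 1 - 2. *)
have sq0 : (a - d) ^+ 2 + (b + c) ^+ 2 = 0 by lra.
move: sq0 => /eqP; rewrite paddr_eq0 ?sqr_ge0// !sqrf_eq0 subr_eq0 addr_eq0.
move=> /andP[/eqP ad /eqP bc]; subst d.
have cb : c = - b by rewrite bc opprK.
subst c; rewrite /rotation /=.
(* Subtracting [e1] from [e0] cancels the squares and leaves a scalar product with the frame;
   likewise with [e2] below. *)
have -> : p.1 = a * z1 + b * z2 by lra.
have -> : p.2 = - b * z1 + a * z2 by lra.
by congr (_ + _, _ + _); rewrite -[LHS]mul1r -e01 /=; ring.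
Qed.
End Euclid.

(** * Certified unions of cells cover all paths *)

Section Soundness.
Variable R : realType.
Implicit Types (p q v : R * R) (a b c : R).

Definition side (N : nat) : R := (N + 2)%:R / (N ^ 2)%:R.

(** The shape of the cells is a parameter: closed cells give a compact cover, half-open ones an
    exact area. *)
Definition cell_union (cell : nat -> nat -> set (R * R)) (B s : nat) :=
  \big[setU/set0]_(k < B ^ 2)
    (if digit 2 s k == 1%N then cell (k %/ B)%N (k %% B)%N else set0).

Lemma cell_unionP cell B s p :
  cell_union cell B s p <-> exists2 k, (k < B ^ 2)%N &
    digit 2 s k = 1%N /\ cell (k %/ B)%N (k %% B)%N p.
Proof.
rewrite /cell_union -(bigcup_mkord _ (fun k => if digit 2 s k == 1%N then
  cell (k %/ B)%N (k %% B)%N else set0)); split.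
  by move=> [k /= kB]; case: eqP => // sk cp; exists k.
by move=> [k kB [sk cp]]; exists k => //; rewrite sk eqxx.
Qed.

Definition closed_cell N (i j : nat) : set (R * R) :=
  `[i%:R * side N, i.+1%:R * side N] `*` `[j%:R * side N, j.+1%:R * side N].

Lemma adiffE m n : (adiff m n)%:R = `|m%:R - n%:R| :> R.
Proof.
rewrite /adiff; have [mn|/ltnW mn] := leqP m n.
  by rewrite (eqP mn) add0n natrB// distrC ger0_norm// subr_ge0 ler_nat.
by rewrite (eqP mn) addn0 natrB// ger0_norm// subr_ge0 ler_nat.
Qed.

Lemma in_stripE (L c pos neg I : nat) : (0 < c)%N ->
  in_strip L c pos neg I <->
  I.+1%:R * L%:R <= (pos%:R - neg%:R : R) / c%:R <= I.+2%:R * L%:R.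
Proof.
move=> c0; have c0' : 0 < c%:R :> R by rewrite ltr0n.
rewrite ler_pdivlMr// ler_pdivrMr// lerBrDr lerBlDr -!natrM -!natrD !ler_nat.
by split=> [[-> ->]|/andP].
Qed.

Lemma strip_neighbour (L z w : R) (I : nat) : 0 <= L ->
  I.+1%:R * L <= z <= I.+2%:R * L -> `|w - z| <= L ->
  exists2 i, (i < 3)%N & (I + i)%:R * L <= w <= (I + i).+1%:R * L.
Proof.
move=> L0 /andP[z1 z2]; rewrite ler_distl => /andP[w1 w2].
have E n : n.+1%:R * L = n%:R * L + L by rewrite -natr1 mulrDl mul1r.
have [h1|h1] := leP w (I.+1%:R * L).
  by exists 0%N => //; rewrite addn0 h1 andbT; move: (E I); lra.
have [h2|h2] := leP w (I.+2%:R * L).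
  by exists 1%N => //; rewrite addn1 h2 ltW.
by exists 2%N => //; rewrite addn2 ltW//=; move: (E I.+2); lra.
Qed.

Lemma cell_index B i j : (j < B)%N ->
  ((i * B + j) %/ B = i)%N /\ ((i * B + j) %% B = j)%N.
Proof.
move=> jB; have B0 := leq_ltn_trans (leq0n j) jB.
by rewrite divnMDl// divn_small// addn0 modnMDl modn_small.
Qed.

Lemma cell_index_lt B i j : (i < B -> j < B -> i * B + j < B ^ 2)%N.
Proof.
move=> iB jB; apply: (@leq_trans (i.+1 * B)).
  by rewrite mulSn addnC ltn_add2r.
by rewrite expnS expn1 leq_mul2r iB orbT.
Qed.

(** The purpose of 3 x 3 blocks: a point within one cell side of a point of the middle cell cannot
    leave the block. *)
Lemma block_covers N B s I J (w z : R * R) : (0 < N)%N -> block_in B s I J ->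
  I.+1%:R * (N + 2)%:R <= z.1 <= I.+2%:R * (N + 2)%:R ->
  J.+1%:R * (N + 2)%:R <= z.2 <= J.+2%:R * (N + 2)%:R ->
  enorm (w - z) <= (N + 2)%:R ->
  cell_union (closed_cell N) B s (w.1 / (N ^ 2)%:R, w.2 / (N ^ 2)%:R).
Proof.
move=> N0 blk z1 z2 wz.
have u0 : 0 < (N ^ 2)%:R :> R by rewrite ltr0n expn_gt0 N0.
have [] := strip_neighbour (ler0n _ _) z1 (le_trans (ler_enorm1 (w - z)) wz).
move=> i i3 /andP[w1l w1r].
have [] := strip_neighbour (ler0n _ _) z2 (le_trans (ler_enorm2 (w - z)) wz).
move=> j j3 /andP[w2l w2r].
have [iB jB sij] := blk i i3 j j3.
apply/cell_unionP; exists ((I + i) * B + (J + j))%N; first exact: cell_index_lt.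
have [-> ->] := cell_index (I + i) jB.
by split=> //; split; rewrite /= in_itv/= /side mulrA ler_pM2r ?invr_gt0//
  mulrA ler_pM2r ?invr_gt0//; apply/andP.
Qed.

Lemma truncn_dist (x : R) : 0 <= x -> `|x - (Num.truncn x)%:R| <= 1.
Proof.
move=> x0; have /andP[h1 h2] := truncn_itv x0.
by rewrite ger0_norm ?subr_ge0// lerBlDl (le_trans (ltW h2))// -natr1.
Qed.

Section Chain.
Variables (f : R -> R * R) (N : nat).
Hypotheses (lipf : lip_path 1 f) (N0 : (0 < N)%N).

Let u : R := (N ^ 2)%:R.
(** The path in grid units, starting at the centre [(u, u)] of the square of side [2 * u], which it
    therefore never leaves. *)
Let F t := u *: (f t - f 0 + (1, 1)) : R * R.
Let px i := Num.truncn (F (i%:R / N%:R)).1.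
Let py i := Num.truncn (F (i%:R / N%:R)).2.

Let NR0 : 0 < N%:R :> R. Proof. by rewrite ltr0n. Qed.
Let u0 : 0 < u. Proof. by rewrite ltr0n expn_gt0 N0. Qed.

Lemma scaled_path_lip t t' : t \in `[0, 1] -> t' \in `[0, 1] ->
  enorm (F t - F t') <= u * `|t - t'|.
Proof.
move=> t01 t'01.
have -> : F t - F t' = u *: (f t - f t').
  by congr (_, _); rewrite /= /GRing.scale /=; ring.
rewrite enormZ gtr0_norm// ler_pM2l//.
by have := lipf t01 t'01; rewrite mul1r dist2E.
Qed.

Lemma scaled_path_bounds t : t \in `[0, 1] ->
  0 <= (F t).1 <= 2 * u /\ 0 <= (F t).2 <= 2 * u.
Proof.
move=> t01; have := scaled_path_lip t01 (_ : 0 \in `[0, 1]).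
rewrite in_itv/= lexx ler01 subr0 => /(_ isT) h.
have ut : u * `|t| <= u.
  move: t01; rewrite in_itv/= => /andP[t0 t1].
  by rewrite ger0_norm// ler_piMr// ltW.
have F0 : F 0 = (u, u).
  by congr (_, _); rewrite /= subrr add0r /GRing.scale /= mulr1.
have := le_trans (le_trans (ler_enorm1 _) h) ut.
have := le_trans (le_trans (ler_enorm2 _) h) ut.
rewrite F0/= !ler_distl => /andP[h1 h2] /andP[h3 h4].
by split; lra.
Qed.

Lemma mesh_itv i : (i <= N)%N -> i%:R / N%:R \in (`[0, 1] : interval R).
Proof.
move=> iN; rewrite in_itv/= divr_ge0//= ler_pdivrMr// mul1r ler_nat //.
Qed.

Lemma scaled_path_round i : (i <= N)%N ->
  enorm (F (i%:R / N%:R) - ((px i)%:R, (py i)%:R)) <= 2.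
Proof.
move=> iN; have [/andP[h1 _] /andP[h2 _]] := scaled_path_bounds (mesh_itv iN).
apply: le_trans (enorm_le_sum _) _ => /=.
by rewrite (_ : 2 = 1 + 1)// lerD// truncn_dist.
Qed.

Lemma rounded_path_lt i : (i <= N)%N ->
  (px i < grid_size N)%N /\ (py i < grid_size N)%N.
Proof.
move=> iN.
have [/andP[h1 h1'] /andP[h2 h2']] := scaled_path_bounds (mesh_itv iN).
by split; rewrite truncn_lt_nat// (le_lt_trans h1', le_lt_trans h2')//
  /grid_size natrD natrM ltrDl.
Qed.

(** Within a time [1 / N] the scaled path moves by at most [u / N], that is [N]; rounding the mesh
    point adds 2. *)
Lemma mesh_approx t : t \in `[0, 1] -> exists2 i, (i <= N)%N &
  enorm (F t - ((px i)%:R, (py i)%:R)) <= (N + 2)%:R.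
Proof.
move=> t01; have := t01; rewrite in_itv/= => /andP[t0 t1].
have Nt0 : 0 <= N%:R * t by rewrite mulr_ge0.
have iN : (Num.truncn (N%:R * t) <= N)%N.
  rewrite -ltnS truncn_lt_nat// (le_lt_trans (_ : _ <= N%:R))//.
    by rewrite ler_piMr.
  by rewrite ltr_nat.
exists (Num.truncn (N%:R * t)) => //; set i := Num.truncn _ in iN *.
have -> : F t - ((px i)%:R, (py i)%:R) =
  (F t - F (i%:R / N%:R)) + (F (i%:R / N%:R) - ((px i)%:R, (py i)%:R)).
  by rewrite subrKA.
apply: le_trans (ler_enormD _ _) _; rewrite natrD.
apply: lerD; last exact: scaled_path_round.
apply: le_trans (scaled_path_lip t01 (mesh_itv iN)) _.
have -> : t - i%:R / N%:R = (N%:R * t - i%:R) / N%:R.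
  by rewrite mulrBl mulrAC divff ?mul1r// gt_eqF.
rewrite normrM normfV (gtr0_norm NR0) /u natrX mulrA ler_pdivrMr// -expr2.
by rewrite mulrC -[leRHS]mul1r ler_pM2r ?exprn_gt0// truncn_dist.
Qed.

(** Both rounding errors lie in [[0, 1[], so they partly cancel. The bound 1, instead of 2, keeps
    the steps of the rounded path below [N + 2]. *)
Lemma truncn_dist2 (x y : R) : 0 <= x -> 0 <= y ->
  `|(Num.truncn x)%:R - (Num.truncn y)%:R - (x - y)| <= 1.
Proof.
move=> /truncn_itv/andP[x1 x2] /truncn_itv/andP[y1 y2].
by rewrite ler_norml; move: x2 y2; rewrite -!natr1; lra.
Qed.

Lemma rounded_path_chain : grid_chain N px py.
Proof.
move=> i iN; have iN' := ltnW iN.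
have [/andP[h1 _] /andP[h2 _]] := scaled_path_bounds (mesh_itv iN').
have [/andP[h3 _] /andP[h4 _]] := scaled_path_bounds (mesh_itv iN).
rewrite -(ler_nat R) natrD !natrX !adiffE !real_normK ?num_real//.
set p : R * R := ((px i.+1)%:R - (px i)%:R, (py i.+1)%:R - (py i)%:R).
rewrite -(@enorm_le _ p)//.
set d := F (i.+1%:R / N%:R) - F (i%:R / N%:R).
rewrite -[p](subrK d) addrC; apply: le_trans (ler_enormD _ _) _.
rewrite natrD lerD//.
  apply: le_trans (scaled_path_lip (mesh_itv iN) (mesh_itv iN')) _.
  rewrite -mulrBl -natr1 addrAC subrr add0r mul1r ger0_norm ?invr_ge0//.
  by rewrite /u natrX expr2 mulfK// gt_eqF.
apply: le_trans (enorm_le_sum _) _ => /=.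
by rewrite (_ : 2 = 1 + 1)// lerD// truncn_dist2.
Qed.

End Chain.

Lemma all_chains_fit_cover N B D s f : (0 < N)%N -> all_chains_fit N B D s ->
  lip_path 1 f -> exists2 sg, Isomp sg &
    forall t, t \in `[0, 1] -> cell_union (closed_cell N) B s (sg (f t)).
Proof.
move=> N0 fits lipf; set u : R := (N ^ 2)%:R.
have u0 : 0 < u by rewrite ltr0n expn_gt0 N0.
pose F t : R * R := u *: (f t - f 0 + (1, 1)).
pose px i := Num.truncn (F (i%:R / N%:R)).1.
pose py i := Num.truncn (F (i%:R / N%:R)).2.
(* The code of the rounded path: abscissas at even digits, ordinates at odd ones. *)
have [k kN|e eW ed] := @digitsP (grid_size N) (2 * N.+1)
    (fun k => if odd k then py k./2 else px k./2).
  have [|hx hy] := @rounded_path_lt f N lipf N0 k./2; last by case: odd.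
  by rewrite -ltnS -(ltn_pmul2l (isT : 0 < 2)%N) (leq_ltn_trans _ kN)// mul2n
    -[leqRHS](odd_double_half k) leq_addl.
have edx i : (i <= N)%N -> chain_x N e i = px i.
  by move=> iN; rewrite /chain_x ed ?ltn_pmul2l// mul2n odd_double doubleK.
have edy i : (i <= N)%N -> chain_y N e i = py i.
  move=> iN; rewrite /chain_y ed;
    last by rewrite mulnS addnC addn2 !ltnS leq_pmul2l.
  by rewrite mul2n /= odd_double/= uphalf_double.
have [|g gD [[c0 abc] pl]] := fits e eW.
  move=> i iN; rewrite !edx ?edy//; try exact: ltnW.
  exact: rounded_path_chain.
move: (digit D g 0) (digit D g 1) (digit D g 2) (digit D g 3) (digit D g 4)
  (digit D g 5) (digit D g 6) (digit D g 7) (digit D g 8) c0 abc pl.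
move=> a1 a2 b1 b2 c x1 x2 y1 y2 c0 abc pl.
have cR : c%:R != 0 :> R by rewrite pnatr_eq0 -lt0n.
pose a : R := (a1%:R - a2%:R) / c%:R; pose b : R := (b1%:R - b2%:R) / c%:R.
have ab : a ^+ 2 + b ^+ 2 = 1.
  move: abc => /(congr1 (fun n => n%:R : R)).
  rewrite !(natrD, natrM, natrX) => abc.
  rewrite /a /b !expr_div_n -mulrDl.
  by apply: (canLR (mulfK (expf_neq0 2 cR))); rewrite mul1r; lra.
pose T : R * R := (x1%:R - x2%:R, y1%:R - y2%:R).
(* The placement acts on [F t] in grid units; this is the same motion read on [f t], after division
   by [u]. *)
exists (fun p => rotation a b p + (rotation a b ((1, 1) - f 0) + u^-1 *: T)).
  exact: rigid_Isomp.
move=> t t01; have [i iN hi] := mesh_approx lipf N0 t01.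
have [I IB [J JB []]] := pl i iN; rewrite edx// edy//.
move=> /(@in_stripE _ _ _ _ _ c0) hI /(@in_stripE _ _ _ _ _ c0) hJ blk.
(* [z] is the image of the nearby grid point, known to lie in the middle of a block, and [w] that of
   the path point. *)
pose z : R * R := rotation a b ((px i)%:R, (py i)%:R) + T.
pose w : R * R := rotation a b (F t) + T.
have := @block_covers N B s I J w z N0 blk.
have -> : z.1 = ((a1 * px i + b2 * py i + c * x1)%:R -
                 (a2 * px i + b1 * py i + c * x2)%:R) / c%:R.
  by rewrite /z /T /= /a /b !(natrD, natrM); field.
have -> : z.2 = ((b1 * px i + a1 * py i + c * y1)%:R -
                 (b2 * px i + a2 * py i + c * y2)%:R) / c%:R.
  by rewrite /z /T /= /a /b !(natrD, natrM); field.
move=> /(_ hI hJ).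
have -> : w - z = rotation a b (F t - ((px i)%:R, (py i)%:R)).
  by rewrite rotB /w /z opprD addrACA subrr addr0.
rewrite enorm_rot// => /(_ hi).
suff -> : (w.1 / (N ^ 2)%:R, w.2 / (N ^ 2)%:R) =
   rotation a b (f t) + (rotation a b ((1, 1) - f 0) + u^-1 *: T) by [].
by congr (_, _); rewrite /w /F /T /rotation /= -/u /GRing.scale /=; field;
  rewrite pnatr_eq0 -lt0n.
Qed.

End Soundness.

(** * From covering all paths to a nonpositive escape value *)

Section EscLe0.
Variable R : realType.
Implicit Types (A D : set (R * R)).

Lemma sup_le0 (E : set R) : (forall x, E x -> x <= 0) -> sup E <= 0.
Proof.
move=> E0; have [->|Ene] := eqVneq E set0; first by rewrite sup0.
by apply: ge_sup => //; apply/set0P.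
Qed.

(* An [inf] over a set which is not bounded below is [0]. *)
Lemma inf_le0 (E : set R) x : E x -> x <= 0 -> inf E <= 0.
Proof.
move=> Ex x0; have [Elb|nE] := pselect (has_lbound E).
  by apply: le_trans x0; exact: ge_inf.
by rewrite inf_out// => -[].
Qed.

Lemma dist_set_ge0 x D : 0 <= dist_set x D.
Proof.
rewrite /dist_set; have [->|Dne] := eqVneq D set0.
  by rewrite image_set0 inf0.
apply: lb_le_inf => [|_ [y _ <-]]; last exact: dist2_ge0.
by have /set0P[y Dy] := Dne; exists (dist2 x y); exists y.
Qed.

(** [sdist A D] is nonpositive on [A]. The default value 0 of [sup] and [inf] respects the bound, so
    degenerate sets do no harm. *)
Lemma esc_le0 A D : (forall f, lip_path 1 f -> exists2 s, Isomp s &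
    forall t, t \in `[0, 1] -> A (s (f t))) -> esc A D 1 <= 0.
Proof.
move=> cov; apply: sup_le0 => _ [f lipf <-].
have [s sI sA] := cov f lipf.
apply: (@inf_le0 _ (con A D (s \o f))); first by exists s.
apply: sup_le0 => _ [t t01 <-].
rewrite /sdist /= mem_set ?oppr_le0 ?dist_set_ge0//.
exact: sA.
Qed.

End EscLe0.

(** * Areas *)

Section Area.
Variable R : realType.
Implicit Types (A U : set (R * R)) (p q : R * R).

Lemma area_setX (I J : set R) : measurable I -> measurable J ->
  area (I `*` J) = (lebesgue_measure I * lebesgue_measure J)%E.
Proof. by move=> mI mJ; rewrite /area product_measure1E. Qed.

Let itv_length (b1 b2 : bool) (x y : R) : x <= y ->
  lebesgue_measure ([set` Interval (BSide b1 x) (BSide b2 y)] : set R) =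
  (y - x)%:E.
Proof.
move=> xy; rewrite lebesgue_measure_itv/= lte_fin.
by case: ltgtP xy => // -> _; rewrite subrr.
Qed.

(* Half-open, so that distinct cells are disjoint; the offset [o] lets cells with
   natural indices reach negative coordinates. *)
Definition half_open_cell N (o : R) (i j : nat) : set (R * R) :=
  `[(i%:R - o) * side R N, (i.+1%:R - o) * side R N[ `*`
  `[(j%:R - o) * side R N, (j.+1%:R - o) * side R N[.

Lemma side_ge0 N : 0 <= side R N.
Proof. by rewrite divr_ge0. Qed.

Lemma side_mulS N (o : R) i : (i%:R - o) * side R N <= (i.+1%:R - o) * side R N.
Proof. by rewrite ler_wpM2r ?side_ge0// lerD2r ler_nat. Qed.

Lemma area_closed_cell N i j :
  area (closed_cell N i j : set (R * R)) = (side R N ^+ 2)%:E.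
Proof.
have le k : k%:R * side R N <= k.+1%:R * side R N.
  by rewrite ler_wpM2r ?side_ge0// ler_nat.
rewrite area_setX//= !itv_length// -EFinM -!mulrBl -!natr1.
by rewrite ![_ + 1 - _]addrAC !subrr !add0r !mul1r.
Qed.

Lemma area_half_open_cell N o i j :
  area (half_open_cell N o i j) = (side R N ^+ 2)%:E.
Proof.
have E (k : nat) : k.+1%:R - o - (k%:R - o) = 1 by rewrite -natr1; ring.
by rewrite area_setX//= !itv_length ?side_mulS// -EFinM -!mulrBl !E !mul1r.
Qed.

Lemma sum_cell_count B s (x : R) :
  (\sum_(k < B ^ 2) (if digit 2 s k == 1%N then x%:E else 0))%E =
  ((cell_count B s)%:R * x)%:E.
Proof.
rewrite /cell_count big_mkord natr_sum mulr_suml -sumEFin.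
apply: eq_bigr => k _; have : (digit 2 s k < 2)%N by exact: ltn_digit.
by case: (digit 2 s k) => [|[|]]//; rewrite ?mul0r ?mul1r.
Qed.

Lemma measurable_cell_union (cell : nat -> nat -> set (R * R)) B s :
  (forall i j, measurable (cell i j)) -> measurable (cell_union cell B s).
Proof.
by move=> mc; apply: bigsetU_measurable => k _; case: ifP.
Qed.

Lemma measurable_closed_cell N i j :
  measurable (closed_cell N i j : set (R * R)).
Proof. exact: measurableX. Qed.

Lemma measurable_half_open_cell N o i j : measurable (half_open_cell N o i j).
Proof. exact: measurableX. Qed.

(** Neighbouring closed cells share edges, so the bound comes from subadditivity. *)
Lemma area_closed_cells N B s :
  (area (cell_union (closed_cell N) B s : set (R * R)) <=
  ((cell_count B s)%:R * side R N ^+ 2)%:E)%E.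
Proof.
rewrite -sum_cell_count.
have := @content_subadditive _ _ _
  ((@lebesgue_measure R) \x (@lebesgue_measure R))%E
  (cell_union (closed_cell N) B s) (fun k => if digit 2 s k == 1%N then
    closed_cell N (k %/ B)%N (k %% B)%N else set0) (B ^ 2)%N.
move=> /(_ _ _ _)/le_trans; apply => //.
- by move=> k _ /=; case: ifP => // _; exact: measurable_closed_cell.
- by apply: measurable_cell_union => *; exact: measurable_closed_cell.
- apply: lee_sum => k _; case: ifP => _; last by rewrite measure0.
  by rewrite -(area_closed_cell N (k %/ B)%N (k %% B)%N).
Qed.

Lemma half_open_cell_inj N o i j i' j' p : (0 < N)%N ->
  half_open_cell N o i j p -> half_open_cell N o i' j' p -> i = i' /\ j = j'.
Proof.
move=> N0; have s0 : 0 < side R N.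
  by rewrite divr_gt0 ?ltr0n ?addn2// expn_gt0 N0.
have H (x : R) a b :
    (a%:R - o) * side R N <= x -> x < (b.+1%:R - o) * side R N -> (a <= b)%N.
  move=> h1 h2; have := le_lt_trans h1 h2.
  by rewrite ltr_pM2r// ltrD2r ltr_nat ltnS.
move=> [] /=; rewrite !in_itv/= => /andP[a1 a2] /andP[b1 b2].
move=> [] /=; rewrite !in_itv/= => /andP[c1 c2] /andP[d1 d2].
by split; apply/eqP; rewrite eqn_leq; apply/andP; split; apply: H; eassumption.
Qed.

Lemma area_half_open_cells N o B s : (0 < N)%N ->
  area (cell_union (half_open_cell N o) B s) =
  ((cell_count B s)%:R * side R N ^+ 2)%:E.
Proof.
move=> N0; rewrite -sum_cell_count.
apply: etrans (@measure_bigsetU _ _ _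
  ((@lebesgue_measure R) \x (@lebesgue_measure R))%E
  (fun k => if digit 2 s k == 1%N then
    half_open_cell N o (k %/ B)%N (k %% B)%N else set0) _ _ (B ^ 2)%N) _.
- by move=> k; case: ifP => // _; exact: measurable_half_open_cell.
- move=> k k' _ _ [p []]; case: ifP => // _ h; case: ifP => // _ h'.
  have [e1 e2] := half_open_cell_inj N0 h h'.
  by rewrite (divn_eq k B) (divn_eq k' B) e1 e2.
- apply: eq_bigr => k _; case: ifP => _; last by rewrite measure0.
  by rewrite -(area_half_open_cell N o (k %/ B)%N (k %% B)%N).
Qed.

Definition box p (r : R) : set (R * R) :=
  [set q | `|q.1 - p.1| < r /\ `|q.2 - p.2| < r].

Lemma measurable_box p r : measurable (box p r).
Proof.
have -> : box p r = `]p.1 - r, p.1 + r[ `*` `]p.2 - r, p.2 + r[.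
  by apply/seteqP; split=> q [] /=; rewrite !in_itv/= -!ltr_distl.
exact: measurableX.
Qed.

(** An open set is the union of the countably many rational boxes that it contains, hence belongs to
    the product sigma-algebra. *)
Lemma measurable_box_open U :
  (forall p, U p -> exists2 e, 0 < e & box p e `<=` U) -> measurable U.
Proof.
move=> oU.
pose c (z : rat * rat * rat) := box (ratr z.1.1, ratr z.1.2) (ratr z.2).
have -> : U = \bigcup_n (if unpickle n is Some z then
    if `[< c z `<=` U >] then c z else set0 else set0).
  apply/seteqP; split=> [p Up|p [n _]]; last first.
    by case: unpickle => // z; case: asboolP => // zU /zU.
  have [e e0 eU] := oU p Up.
  (* A box of radius [r] whose centre is within [r] of [p] in both coordinates contains [p], and
     lies in [box p e] because [2 * r < e]. *)
  have [r] : exists r : rat, ratr r \in `]0, e / 2[ by apply: rat_in_itvoo; lra.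
  rewrite in_itv/= => /andP[r0 re].
  have [x] : exists x : rat, ratr x \in `]p.1 - ratr r, p.1[.
    by apply: rat_in_itvoo; lra.
  rewrite in_itv/= => /andP[x1 x2].
  have [y] : exists y : rat, ratr y \in `]p.2 - ratr r, p.2[.
    by apply: rat_in_itvoo; lra.
  rewrite in_itv/= => /andP[y1 y2].
  exists (pickle (x, y, r)); first exact: I.
  rewrite pickleK; case: asboolP => [_|].
    by split=> /=; rewrite ltr_norml; lra.
  case=> q [] /=; rewrite !ltr_norml => /andP[q1 q2] /andP[q3 q4].
  by apply: eU; split; rewrite ltr_norml; lra.
apply: bigcupT_measurable => n; case: unpickle => // z.
by case: ifP => // _; exact: measurable_box.
Qed.

Definition box_nbhd A (r : R) : set (R * R) :=
  [set p | exists2 q, A q & box q r p].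

Lemma measurable_box_nbhd A r : measurable (box_nbhd A r).
Proof.
apply: measurable_box_open => p [q Aq [h1 h2]].
pose m := Num.min (r - `|p.1 - q.1|) (r - `|p.2 - q.2|).
have m1 : m <= r - `|p.1 - q.1| by rewrite ge_min lexx.
have m2 : m <= r - `|p.2 - q.2| by rewrite ge_min lexx orbT.
exists m; first by rewrite lt_min !subr_gt0 h1 h2.
move=> p' [h3 h4]; exists q => //; split.
  by rewrite -(subrKA p.1); apply: le_lt_trans (ler_normD _ _) _; lra.
by rewrite -(subrKA p.2); apply: le_lt_trans (ler_normD _ _) _; lra.
Qed.

Lemma nbhs_box p (U : set (R * R)) :
  nbhs p U -> exists2 e, 0 < e & box p e `<=` U.
Proof.
move=> /nbhs_ballP[e /= e0 h]; exists e => // q [h1 h2]; apply: h.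
by split; rewrite /ball/= distrC.
Qed.

Lemma compact_box_bounded A :
  compact A -> exists2 M : R, 0 < M & A `<=` box (0, 0) M.
Proof.
move=> /compact_bounded[M [_ hM]]; exists (Num.max M 0 + 2).
  by rewrite ltr_wpDl// le_max lexx orbT.
move=> p Ap; have := hM (Num.max M 0 + 1) _ p Ap.
have -> : M < Num.max M 0 + 1 by rewrite ltr_pwDr// le_max lexx.
move=> /(_ isT); rewrite /Num.norm/= ge_max => /andP[h1 h2].
by split; rewrite /= subr0; lra.
Qed.

Lemma closed_compact_plane A : compact A -> closed A.
Proof.
by apply: compact_closed; exact: norm_hausdorff.
Qed.

Lemma bigcap_box_nbhd A : closed A -> \bigcap_n box_nbhd A n.+1%:R^-1 = A.
Proof.
move=> clA; apply/seteqP; split=> [p hp|p Ap n _]; last first.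
  by exists p => //; split; rewrite subrr normr0 invr_gt0.
apply: clA => U /nbhs_box[e e0 eU].
pose n := Num.truncn e^-1.
have [q Aq [h1 h2]] := hp n I; exists q; split=> //; apply: eU.
have ne : n.+1%:R^-1 < e.
  by rewrite invf_plt ?posrE// truncnS_gt.
by split; rewrite distrC; apply: lt_trans ne.
Qed.

Lemma compact_plane_measurable A : compact A -> measurable A.
Proof.
move=> cA; rewrite -(bigcap_box_nbhd (closed_compact_plane cA)).
by apply: bigcapT_measurable => n; exact: measurable_box_nbhd.
Qed.

Lemma area_box_fin p r : (area (box p r) < +oo)%E.
Proof.
have [r0|r0] := ltP r 0.
  suff -> : box p r = set0 by rewrite /area measure0.
  by apply/seteqP; split=> // q [h _]; have := normr_ge0 (q.1 - p.1); lra.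
have -> : box p r = `]p.1 - r, p.1 + r[ `*` `]p.2 - r, p.2 + r[.
  by apply/seteqP; split=> q [] /=; rewrite !in_itv/= -!ltr_distl.
by rewrite area_setX// !itv_length -?EFinM ?ltry//; lra.
Qed.

Lemma area_box_nbhd_fin A r : compact A -> (area (box_nbhd A r) < +oo)%E.
Proof.
move=> /compact_box_bounded[M M0 AM].
apply: le_lt_trans (area_box_fin (0, 0) (M + r)).
apply: le_measure; rewrite ?inE.
- exact: measurable_box_nbhd.
- exact: measurable_box.
move=> p [q /AM[]/=]; rewrite !subr0 => h1 h2 [h3 h4].
split; rewrite /= subr0.
  by rewrite -[p.1](subrK q.1); apply: le_lt_trans (ler_normD _ _) _; lra.
by rewrite -[p.2](subrK q.2); apply: le_lt_trans (ler_normD _ _) _; lra.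
Qed.

Lemma sub_box_nbhd A r : 0 < r -> A `<=` box_nbhd A r.
Proof. by move=> r0 p Ap; exists p => //; split; rewrite subrr normr0. Qed.

Lemma area_compact_fin A : compact A -> area A \is a fin_num.
Proof.
move=> cA; rewrite ge0_fin_numE ?measure_ge0//.
apply: le_lt_trans (area_box_nbhd_fin 1 cA).
apply: le_measure; rewrite ?inE; last exact: sub_box_nbhd.
  exact: compact_plane_measurable.
exact: measurable_box_nbhd.
Qed.

(** Continuity of the measure from above: the neighbourhoods of radius [1 / (n + 1)] decrease to
    [A], and the first has finite area. *)
Lemma area_box_nbhd A (x : R) : compact A -> (area A < x%:E)%E ->
  exists2 r, 0 < r & (area (box_nbhd A r) < x%:E)%E.
Proof.
move=> cA Ax; pose F n := box_nbhd A n.+1%:R^-1.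
have mF n : measurable (F n) by exact: measurable_box_nbhd.
have cap : \bigcap_n F n = A.
  by apply: bigcap_box_nbhd; exact: closed_compact_plane.
have := @nonincreasing_cvg_mu _ _ _
  ((@lebesgue_measure R) \x (@lebesgue_measure R))%E F.
rewrite -[X in (X < _)%E]/(area (F 0%N)) cap.
have F0 : (area (F 0%N) < +oo)%E. by exact: area_box_nbhd_fin.
move=> /(_ F0 mF).
move=> /(_ (compact_plane_measurable cA)).
have nF : {homo F : n m / (n <= m)%N >-> (m <= n)%O}.
  move=> n m nm; apply/subsetPset => p [q Aq [h1 h2]]; exists q => //.
  have le : m.+1%:R^-1 <= n.+1%:R^-1 :> R by rewrite lef_pV2 ?posrE// ler_nat.
  by split; [apply: lt_le_trans h1 _|apply: lt_le_trans h2 _].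
move=> /(_ nF) cv.
have [|n _ hn] := cv [set y | (y < x%:E)%E].
  by apply: open_nbhs_nbhs; split=> //; exact: open_ereal_lt_ereal.
exists n.+1%:R^-1; first by rewrite invr_gt0.
exact: (hn n (leqnn n)).
Qed.

End Area.

(** * Existence of certificates *)

Section EscNear.
Variable R : realType.
Implicit Types (A D : set (R * R)) (p q : R * R).

Lemma compact_boundary A : compact A -> A !=set0 -> boundary A !=set0.
Proof.
move=> cA A0; have [|p pA pmax] := @compact_EVT_max _ _ (@fst R R) A A0 cA.
  by apply: continuous_subspaceT => q; exact: cvg_fst.
(* The rightmost point [p] of [A] is not interior. *)
exists p; split; first by apply: subset_closure; exact: set_mem.
rewrite /interior => /nbhs_box[e e0 eA].
have : A (p.1 + e / 2, p.2).
  apply: eA; split=> /=; last by rewrite subrr normr0.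
  by rewrite addrAC subrr add0r gtr0_norm; lra.
move=> /mem_set /pmax /=; lra.
Qed.

Lemma boundary_sub A : compact A -> boundary A `<=` A.
Proof.
move=> /closed_compact_plane clA p [cp _].
by move: cp; rewrite -((closure_id A).1 clA).
Qed.

Lemma dist_set_le D p q : D q -> dist_set p D <= dist2 p q.
Proof.
move=> Dq; apply: ge_inf; last by exists q.
by exists 0 => _ [q' _ <-]; exact: dist2_ge0.
Qed.

Lemma shift_Isomp v : Isomp (fun p : R * R => p + v).
Proof.
have h : 1 ^+ 2 + 0 ^+ 2 = 1 :> R by rewrite expr0n expr1n addr0.
have := rigid_Isomp v h; congr (Isomp _).
apply/funext => p; congr (_ + _).
by rewrite /rotation !mul1r !mul0r subr0 add0r -surjective_pairing.
Qed.

Section Near.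
Variables (A : set (R * R)) (f : R -> R * R).
Hypotheses (cA : compact A) (A0 : A !=set0) (lipf : lip_path 1 f).
Let D := boundary A.

Let lip0 t : t \in `[0, 1] -> dist2 (f t) (f 0) <= 1.
Proof.
move=> t01; have := lipf t01 (_ : 0 \in `[0, 1]).
rewrite in_itv/= lexx ler01 subr0 mul1r => /(_ isT) /le_trans; apply.
by move: t01; rewrite in_itv/= => /andP[t0 t1]; rewrite ger0_norm.
Qed.

Let sdist_le p q : D q -> sdist A D p <= dist2 p q.
Proof.
move=> Dq; rewrite /sdist; case: ifP => _; last exact: dist_set_le.
apply: (@le_trans _ _ 0); last exact: dist2_ge0.
by rewrite oppr_le0 dist_set_ge0.
Qed.

(** Makes [con] a genuine supremum: the image path stays within 1 of its start, and [sdist] is at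
    most the distance to a boundary point. *)
Let con_ub s : Isomp s -> has_sup [set sdist A D ((s \o f) t) | t in `[0, 1]].
Proof.
move=> [ds _]; split.
  by exists (sdist A D (s (f 0))); exists 0 => //=; rewrite in_itv/= lexx ler01.
have [q Dq] := compact_boundary cA A0.
exists (1 + dist2 (s (f 0)) q) => _ [t t01 <-] /=.
apply: le_trans (sdist_le _ Dq) _.
apply: le_trans (dist2_triangle (s (f 0)) _ _) _.
by rewrite lerD2r ds lip0.
Qed.

(** Makes [wcc] a genuine infimum: the depth of a point of [A] is at most its distance to a fixed
    boundary point, bounded since [A] is. *)
Let con_lb : has_lbound [set con A D (s \o f) | s in @Isomp R].
Proof.
have [q Dq] := compact_boundary cA A0.
have [M M0 AM] := compact_box_bounded cA.
exists (- (M + M + dist2 (0, 0) q)) => _ [s sI <-].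
apply: (@le_trans _ _ (sdist A D (s (f 0)))); last first.
  apply: ub_le_sup; first by have [] := con_ub sI.
  by exists 0 => //=; rewrite in_itv/= lexx ler01.
rewrite /sdist; case: ifP => [/set_mem|_].
  move=> /AM[/ltW h1 /ltW h2]; rewrite lerN2.
  apply: le_trans (dist_set_le _ Dq) _.
  apply: le_trans (dist2_triangle (0, 0) _ _) _; rewrite lerD2r dist2E.
  by apply: le_trans (enorm_le_sum _) _; exact: lerD.
apply: (@le_trans _ _ 0); last exact: dist_set_ge0.
by rewrite oppr_le0 addr_ge0 ?dist2_ge0// addr_ge0// ltW.
Qed.

(** Translate the path so that it starts on the boundary. The bound is uniform in [f], which makes
    [esc] a genuine supremum. *)
Lemma wcc_le1 : wcc A D f <= 1.
Proof.
have [q Dq] := compact_boundary cA A0.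
apply: (@le_trans _ _ (con A D ((fun p => p + (q - f 0)) \o f))).
  apply: ge_inf => //.
  by exists (fun p => p + (q - f 0)) => //; exact: shift_Isomp.
apply: ge_sup => [|_ [t t01 <-]].
  by have [] := con_ub (shift_Isomp (q - f 0)).
apply: le_trans (sdist_le _ Dq) _ => /=.
rewrite dist2E (_ : _ - q = f t - f 0); first by rewrite -dist2E lip0.
by rewrite addrA addrAC addrK.
Qed.

(** A point with [sdist] below [e] is in [A] or within [e] of its boundary, which is part of [A].
    The slack [e] avoids having to show that the infimum is attained. *)
Lemma wcc_lt_near (e : R) : wcc A D f < e -> 0 < e -> exists2 s, Isomp s &
  forall t, t \in `[0, 1] -> exists2 a, A a & dist2 (s (f t)) a < e.
Proof.
have ne : [set con A D (s \o f) | s in @Isomp R] !=set0.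
  exists (con A D ((fun p => p + 0) \o f)).
  by exists (fun p => p + 0) => //; exact: shift_Isomp.
move=> /(inf_lt ne)[_ [s sI <-] se] e0; exists s => // t t01.
have : sdist A D (s (f t)) < e.
  apply: le_lt_trans se; apply: ub_le_sup; first by have [] := con_ub sI.
  by exists t.
rewrite /sdist; case: ifP => [/set_mem sA _|_].
  by exists (s (f t)) => //; rewrite dist2E subrr /enorm/= expr0n addr0 sqrtr0.
move=> /inf_lt[|_ [q Dq <-] qe].
  have [q Dq] := compact_boundary cA A0.
  by exists (dist2 (s (f t)) q); exists q.
by exists q => //; exact: boundary_sub Dq.
Qed.

End Near.

Lemma esc_le0_near A f (e : R) : compact A -> A !=set0 ->
  esc A (boundary A) 1 <= 0 -> lip_path 1 f -> 0 < e -> exists2 s, Isomp s &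
  forall t, t \in `[0, 1] -> exists2 a, A a & dist2 (s (f t)) a < e.
Proof.
move=> cA A0 escA lipf e0; apply: wcc_lt_near => //.
apply: le_lt_trans e0; apply: le_trans escA.
apply: ub_le_sup; last by exists f.
by exists 1 => _ [g lipg <-]; exact: wcc_le1.
Qed.

End EscNear.

(** * Polygons through the points of a chain *)

Section Polygon.
Variable R : realType.

(** [clamp (z - i%:R)] is the fraction of edge [i] travelled at time [z], one unit of time being
    spent on each edge. *)
Definition clamp (z : R) : R := Num.max 0 (Num.min 1 z).

Lemma clamp0 z : z <= 0 -> clamp z = 0.
Proof.
by move=> z0; rewrite /clamp; case: (leP 1 z) => h; apply/max_idPl; lra.
Qed.

Lemma clamp1 z : 1 <= z -> clamp z = 1.
Proof. by move=> z1; rewrite /clamp (min_idPl z1); apply/max_idPr. Qed.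

Lemma clamp_mid z : 0 <= z <= 1 -> clamp z = z.
Proof.
by move=> /andP[z0 z1]; rewrite /clamp (min_idPr z1); apply/max_idPr.
Qed.

Lemma le_clamp z z' : z <= z' -> clamp z <= clamp z'.
Proof.
move=> zz'; rewrite /clamp ge_max; apply/andP; split.
  by rewrite le_max lexx.
by rewrite le_max le_min !ge_min lexx zz' !orbT.
Qed.

Lemma sum_clamp_min z n : 0 <= z ->
  \sum_(i < n) clamp (z - i%:R) = Num.min z n%:R.
Proof.
move=> z0; elim: n => [|n ih]; first by rewrite big_ord0; apply/esym/min_idPr.
rewrite big_ord_recr/= ih -natr1.
have [h|h] := leP z n%:R.
  rewrite clamp0 ?subr_le0// addr0; apply/esym/min_idPl; lra.
have [h'|h'] := leP z (n%:R + 1).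
  by rewrite clamp_mid ?subr_ge0 ?(ltW h)//; lra.
by rewrite clamp1//; lra.
Qed.

Lemma enorm_sum n (d : nat -> R * R) :
  enorm (\sum_(i < n) d i) <= \sum_(i < n) enorm (d i).
Proof.
elim: n => [|n ih]; first by rewrite !big_ord0 /enorm/= expr0n addr0 sqrtr0.
by rewrite !big_ord_recr/=; apply: le_trans (ler_enormD _ _) _; rewrite lerD2r.
Qed.

Variables (P : nat -> R * R) (N : nat) (K : R).
Hypotheses (N0 : (0 < N)%N) (K0 : 0 < K).
Hypothesis stepP : forall i, (i < N)%N -> enorm (P i.+1 - P i) <= K.

(* The factor makes the polygon 1-Lipschitz. *)
Definition polygon t : R * R :=
  (K * N%:R)^-1 *:
  (P 0%N + \sum_(i < N) clamp (N%:R * t - i%:R) *: (P i.+1 - P i)).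

Let NR0 : 0 < N%:R :> R. Proof. by rewrite ltr0n. Qed.

(** Each edge contributes at most [K] times the increase of its fraction; by [sum_clamp_min] the
    increases add up to [N * (t - u)], and the scaling factor cancels [K * N]. *)
Lemma polygon_lip_le t u : 0 <= u -> u <= t -> t <= 1 ->
  dist2 (polygon t) (polygon u) <= t - u.
Proof.
move=> u0 ut t1; rewrite dist2E -scalerBr enormZ.
rewrite opprD addrACA subrr add0r -sumrB gtr0_norm ?invr_gt0 ?mulr_gt0//.
rewrite mulrC ler_pdivrMr ?mulr_gt0//.
under eq_bigr do rewrite -scalerBl.
pose d i := clamp (N%:R * t - i%:R) - clamp (N%:R * u - i%:R).
apply: le_trans (enorm_sum _ (fun i => d i *: (P i.+1 - P i))) _.
have tu : N%:R * u <= N%:R * t by rewrite ler_pM2l.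
apply: (@le_trans _ _ (\sum_(i < N) d i * K)).
  apply: ler_sum => i _; rewrite enormZ ger0_norm; last first.
    by rewrite subr_ge0 le_clamp// lerB.
  by rewrite ler_wpM2l ?stepP// subr_ge0 le_clamp// lerB.
have t0 := le_trans u0 ut.
rewrite -mulr_suml sumrB !sum_clamp_min ?(mulr_ge0 (ler0n _ _))//.
have ht : N%:R * t <= N%:R by rewrite ler_piMr.
rewrite (min_idPl ht) (min_idPl (le_trans tu ht)).
by rewrite le_eqVlt; apply/orP; left; apply/eqP; ring.
Qed.

Lemma polygon_lip : lip_path 1 polygon.
Proof.
move=> t u; rewrite !in_itv/= => /andP[t0 t1] /andP[u0 u1]; rewrite mul1r.
have [ut|/ltW tu] := leP u t.
  by rewrite ger0_norm ?subr_ge0// polygon_lip_le.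
by rewrite dist2C distrC ger0_norm ?subr_ge0// polygon_lip_le.
Qed.

Lemma polygon_vertex j : (j <= N)%N ->
  polygon (j%:R / N%:R) = (K * N%:R)^-1 *: P j.
Proof.
move=> jN; congr (_ *: _).
rewrite [N%:R * _]mulrC divfK ?gt_eqF//.
suff H n : \sum_(i < n) clamp (j%:R - i%:R) *: (P i.+1 - P i) =
    P (minn j n) - P 0%N.
  by rewrite H (minn_idPl jN) addrC subrK.
elim: n => [|n ih]; first by rewrite big_ord0 minn0 subrr.
rewrite big_ord_recr/= ih; have [nj|jn] := ltnP n j.
  rewrite clamp1 ?scale1r; last by rewrite lerBrDr nat1r ler_nat.
  by rewrite (minn_idPr nj) addrC subrKA.
rewrite clamp0 ?subr_le0 ?ler_nat// scale0r addr0.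
by rewrite (minn_idPl (leqW jn)).
Qed.

End Polygon.

(** * Rational approximation of rotations *)

Section RationalRotation.
Variable R : realType.

Lemma nat_sub_approx (x : R) : exists m n : nat, `|m%:R - n%:R - x| <= 1.
Proof.
have [x0|x0] := leP 0 x.
  by exists (Num.truncn x), 0%N; rewrite subr0 distrC truncn_dist.
exists 0%N, (Num.truncn (- x)); rewrite sub0r addrC truncn_dist//.
by rewrite oppr_ge0 ltW.
Qed.

(* The inverse stereographic projection is [2]-Lipschitz. *)
Lemma pythagorean_lip (s t : R) :
  `|(1 - s ^+ 2) / (1 + s ^+ 2) - (1 - t ^+ 2) / (1 + t ^+ 2)| <=
    2 * `|s - t| /\
  `|2 * s / (1 + s ^+ 2) - 2 * t / (1 + t ^+ 2)| <= 2 * `|s - t|.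
Proof.
have s0 : 0 < 1 + s ^+ 2 by rewrite ltr_wpDr ?sqr_ge0.
have t0 : 0 < 1 + t ^+ 2 by rewrite ltr_wpDr ?sqr_ge0.
have st0 : 0 < (1 + s ^+ 2) * (1 + t ^+ 2) by rewrite mulr_gt0.
have H x : `|x| <= (1 + s ^+ 2) * (1 + t ^+ 2) ->
    `|2 * (s - t) * x / ((1 + s ^+ 2) * (1 + t ^+ 2))| <= 2 * `|s - t|.
  move=> hx; rewrite !normrM normfV (gtr0_norm st0) ler_pdivrMr//.
  rewrite (ger0_norm (ler0n _ 2)).
  by rewrite ler_wpM2l// mulr_ge0.
have p1 := sqr_ge0 s; have p2 := sqr_ge0 t; have p3 := mulr_ge0 p1 p2.
split.
  have -> : (1 - s ^+ 2) / (1 + s ^+ 2) - (1 - t ^+ 2) / (1 + t ^+ 2) =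
      2 * (s - t) * (- (s + t)) / ((1 + s ^+ 2) * (1 + t ^+ 2)).
    by field; rewrite !gt_eqF.
  apply: H; rewrite normrN ler_norml.
  have := sqr_ge0 (s - 1); have := sqr_ge0 (t - 1).
  have := sqr_ge0 (s + 1); have := sqr_ge0 (t + 1).
  by lra.
have -> : 2 * s / (1 + s ^+ 2) - 2 * t / (1 + t ^+ 2) =
    2 * (s - t) * (1 - s * t) / ((1 + s ^+ 2) * (1 + t ^+ 2)).
  by field; rewrite !gt_eqF.
apply: H; rewrite ler_norml.
have := sqr_ge0 (s - t); have := sqr_ge0 (s + t).
by lra.
Qed.

(** Project the circle stereographically from [(-1, 0)], replace the parameter [s] by a nearby
    rational [t], and project back. *)
Lemma rational_rotation (a b e : R) : a ^+ 2 + b ^+ 2 = 1 -> 0 < e ->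
  exists a1 a2 b1 b2 c : nat, [/\ placement a1 a2 b1 b2 c,
    `|(a1%:R - a2%:R) / c%:R - a| <= e & `|(b1%:R - b2%:R) / c%:R - b| <= e].
Proof.
(* The centre of projection has no parameter, but is itself rational. *)
move=> ab e0; have [aN1|aN1] := eqVneq a (-1).
  have b0 : b = 0.
    apply/eqP; rewrite -sqrf_eq0; apply/eqP.
    by move: ab; rewrite aN1 sqrrN expr1n; lra.
  exists 0%N, 1%N, 0%N, 0%N, 1%N; split=> //.
    by rewrite aN1 divr1 sub0r opprK addNr normr0 ltW.
  by rewrite b0 subrr mul0r subr0 normr0 ltW.
have a1 : 0 < 1 + a.
  rewrite lt_neqAle eq_sym addrC addr_eq0 aN1/=.
  have := sqr_ge0 b; have := sqr_ge0 (a - 1); nra.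
pose s := b / (1 + a).
have bs : b = s * (1 + a) by rewrite divfK// gt_eqF.
have s2 : s ^+ 2 * (1 + a) = 1 - a.
  apply: (mulIf (lt0r_neq0 a1)); rewrite -mulrA -expr2 -exprMn -bs; nra.
have s0 : 0 < 1 + s ^+ 2 by rewrite ltr_wpDr ?sqr_ge0.
have sa : (1 + s ^+ 2) * (1 + a) = 2 by lra.
have aE : a = (1 - s ^+ 2) / (1 + s ^+ 2).
  by apply/esym/(canLR (mulfK (lt0r_neq0 s0))); lra.
have bE : b = 2 * s / (1 + s ^+ 2).
  by apply/esym/(canLR (mulfK (lt0r_neq0 s0))); rewrite bs -sa; ring.
(* [t] will be within [1 / k] of [s], and projecting back at most doubles this error. *)
pose k := (Num.truncn (2 / e)).+1.
have k0 : 0 < k%:R :> R by rewrite ltr0n.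
have ke : 2 * k%:R^-1 <= e.
  by rewrite ler_pdivrMr// mulrC -ler_pdivrMr// ltW// truncnS_gt.
have [m [n mn]] := nat_sub_approx (k%:R * s).
pose t : R := (m%:R - n%:R) / k%:R.
have ts : 2 * `|t - s| <= e.
  apply: le_trans ke; rewrite ler_pM2l//.
  have -> : t - s = (m%:R - n%:R - k%:R * s) / k%:R.
    by rewrite mulrBl mulrAC divff ?mul1r// gt_eqF.
  by rewrite normrM normfV (gtr0_norm k0) ler_pdivrMr// mulVf ?gt_eqF.
(* With [d = m - n], this is the Pythagorean triple [k^2 - d^2], [2 d k], [k^2 + d^2], its signed
   entries split into positive and negative terms. *)
exists (k ^ 2 + 2 * m * n)%N, (m ^ 2 + n ^ 2)%N, (2 * m * k)%N, (2 * n * k)%N,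
  (k ^ 2 + adiff m n ^ 2)%N.
have ad : (adiff m n)%:R ^+ 2 = (m%:R - n%:R) ^+ 2 :> R.
  by rewrite adiffE real_normK ?num_real.
have t0 : 0 < 1 + t ^+ 2 by rewrite ltr_wpDr ?sqr_ge0.
have cE : (k ^ 2 + adiff m n ^ 2)%:R = k%:R ^+ 2 * (1 + t ^+ 2) :> R.
  by rewrite natrD !natrX ad /t; field; rewrite gt_eqF.
have [h1 h2] := pythagorean_lip t s.
split.
- split; first by rewrite addn_gt0 expn_gt0.
  apply/eqP; rewrite -(eqr_nat R) [X in _ == X]natrD [((_ + _) ^ 2)%:R]natrX cE.
  by rewrite !(natrD, natrM, natrX) /t; apply/eqP; field; rewrite gt_eqF.
- rewrite cE; have -> : ((k ^ 2 + 2 * m * n)%:R - (m ^ 2 + n ^ 2)%:R) =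
      k%:R ^+ 2 * (1 - t ^+ 2) :> R.
    by rewrite !(natrD, natrM, natrX) /t; field; rewrite gt_eqF.
  by rewrite -mulf_div divff ?mul1r ?expf_neq0 ?gt_eqF// aE (le_trans h1).
- rewrite cE; have -> : ((2 * m * k)%:R - (2 * n * k)%:R) =
      k%:R ^+ 2 * (2 * t) :> R.
    by rewrite !(natrD, natrM, natrX) /t; field; rewrite gt_eqF.
  by rewrite -mulf_div divff ?mul1r ?expf_neq0 ?gt_eqF// bE (le_trans h2).
Qed.

End RationalRotation.

Lemma chain_fits_intro N B s x y (a1 a2 b1 b2 c x1 x2 y1 y2 : nat) :
  placement a1 a2 b1 b2 c ->
  (forall i, (i < N.+1)%N ->
     placed (N + 2) B s a1 a2 b1 b2 c x1 x2 y1 y2 (x i) (y i)) ->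
  exists D0, forall D, (D0 <= D)%N -> chain_fits N B D s x y.
Proof.
move=> pl fit; pose vs := [:: a1; a2; b1; b2; c; x1; x2; y1; y2].
exists (sumn vs).+1 => D hD.
have [|g gD gE] := @digitsP D 9 (nth 0%N vs).
  move=> k k9; apply: leq_trans hD; rewrite ltnS.
  (* Rotating the list brings entry [k] to the front, so it is at most the sum. *)
  by rewrite -(sumn_rot vs k) /seq.rot (drop_nth 0%N)// cat_cons leq_addr.
by exists g => //; rewrite !gE.
Qed.

(** Serves to choose one [D] for all of the finitely many chains; the threshold form of the
    hypothesis allows taking a maximum. *)
Lemma exists_bound_all E (Q : nat -> nat -> Prop) :
  (forall e, (e < E)%N -> exists D0, forall D, (D0 <= D)%N -> Q e D) ->
  exists D0, forall D, (D0 <= D)%N -> forall e, (e < E)%N -> Q e D.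
Proof.
elim: E => [|E ih] h; first by exists 0%N.
have [e eE|D0 h0] := ih; first by apply: h; exact: leqW.
have [D1 h1] := h E (ltnSn E).
exists (maxn D0 D1) => D; rewrite geq_max => /andP[d0 d1] e.
by rewrite ltnS leq_eqVlt => /orP[/eqP->|]; [exact: h1|exact: h0].
Qed.

(** * Chains fit in the cells near a compact cover *)

Section Completeness.
Variable R : realType.
Implicit Types (A : set (R * R)) (p q : R * R).

Lemma strip_exists (L H : nat) (z : R) : (0 < L)%N ->
  `|z| <= (H%:R - 2) * L%:R -> exists2 I, (I + 2 < H.*2)%N &
  I.+1%:R * L%:R <= z + H%:R * L%:R <= I.+2%:R * L%:R.
Proof.
move=> L0; have L0' : 0 < L%:R :> R by rewrite ltr0n.
rewrite ler_norml => /andP[z1 z2]; pose w := (z + H%:R * L%:R) / L%:R.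
have wE : z + H%:R * L%:R = w * L%:R by rewrite divfK ?gt_eqF.
have w2 : 2 <= w by rewrite ler_pdivlMr//; lra.
have wH : w <= H.*2%:R - 2.
  by rewrite ler_pdivrMr// -muln2 natrM; lra.
have /truncn_itv/andP[t1 t2] : 0 <= w by lra.
have t0 : (1 < Num.truncn w)%N.
  by rewrite -(ltr_nat R); move: t2; rewrite -natr1; lra.
exists (Num.truncn w).-1.
  by rewrite addn2 prednK ?(ltnW t0)// -(ltr_nat R) -natr1; lra.
by rewrite wE !ler_pM2r// prednK ?(ltnW t0)// t1 ltW.
Qed.

(** Both points lie in three consecutive strips and [z] in the middle one, so they are at most two
    widths apart. *)
Lemma cell_strip_close (N H I i : nat) (x z : R) : (0 < N)%N -> (i < 3)%N ->
  x \in `[((I + i)%:R - H%:R) * side R N, ((I + i).+1%:R - H%:R) * side R N[ ->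
  I.+1%:R * (N + 2)%:R <= z + H%:R * (N + 2)%:R <= I.+2%:R * (N + 2)%:R ->
  `|(N ^ 2)%:R * x - z| <= 2 * (N + 2)%:R.
Proof.
move=> N0 i3; rewrite in_itv/= => /andP[x1 x2] /andP[z1 z2].
have u0 : 0 < (N ^ 2)%:R :> R by rewrite ltr0n expn_gt0 N0.
have sE : (N ^ 2)%:R * side R N = (N + 2)%:R.
  by rewrite /side mulrC divfK ?gt_eqF.
move: x1; rewrite -(ler_pM2l u0) mulrCA sE => x1.
move: x2; rewrite -(ltr_pM2l u0) mulrCA sE => x2.
have L0 : 0 <= (N + 2)%:R :> R by [].
have E n : n.+1%:R = n%:R + 1 :> R by rewrite natr1.
rewrite natrD in x1; rewrite E natrD in x2; rewrite E in z1; rewrite !E in z2.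
have i2 : i%:R <= 2 :> R by rewrite (ler_nat R i 2).
have h1 := mulr_ge0 (ler0n R i) L0.
have h2 : 0 <= (2 - i%:R) * (N + 2)%:R :> R by rewrite mulr_ge0// subr_ge0.
move: ((N + 2)%:R : R) L0 x1 x2 z1 z2 h1 h2 => L L0 x1 x2 z1 z2 h1 h2.
by rewrite ler_norml; lra.
Qed.

Section Chain.
Variables (A : set (R * R)) (r M : R) (N H B s : nat).
Hypotheses (cA : compact A) (A0 : A !=set0) (escA : esc A (boundary A) 1 <= 0).
Hypotheses (N0 : (0 < N)%N) (Nr : 25 < r * N%:R) (AM : A `<=` box (0, 0) M).
Hypothesis HM : (N ^ 2)%:R * M + 19 * N%:R <= H%:R - 2.
Hypothesis Bdef : B = H.*2.
Hypothesis sP : forall k, (k < B ^ 2)%N ->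
  half_open_cell N H%:R (k %/ B) (k %% B) `<=` box_nbhd A r ->
  digit 2 s k = 1%N.

Let u : R := (N ^ 2)%:R.
Let NR1 : 1 <= N%:R :> R. Proof. by rewrite ler1n. Qed.
Let NR0 : 0 < N%:R :> R. Proof. by rewrite ltr0n. Qed.
Let uE : u = N%:R ^+ 2. Proof. by rewrite /u natrX. Qed.
Let u0 : 0 < u. Proof. by rewrite uE exprn_gt0. Qed.

Lemma near_cell_block I J a (z : R * R) : A a ->
  (I + 2 < B)%N -> (J + 2 < B)%N ->
  I.+1%:R * (N + 2)%:R <= z.1 + H%:R * (N + 2)%:R <= I.+2%:R * (N + 2)%:R ->
  J.+1%:R * (N + 2)%:R <= z.2 + H%:R * (N + 2)%:R <= J.+2%:R * (N + 2)%:R ->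
  enorm (z - u *: a) <= 19 * N%:R -> block_in B s I J.
Proof.
move=> Aa IB JB z1 z2 za i i3 j j3.
have lt3 k l : (l + 2 < B)%N -> (k < 3)%N -> (l + k < B)%N.
  by move=> lB k3; apply: leq_ltn_trans lB; rewrite leq_add2l -ltnS.
have iB := lt3 _ _ IB i3; have jB := lt3 _ _ JB j3.
split=> //; apply: sP; first exact: cell_index_lt.
have [-> ->] := cell_index (I + i) jB.
move=> p [/= /(cell_strip_close N0 i3)/(_ z1) h1].
move=> /(cell_strip_close N0 j3)/(_ z2) h2.
have /le_trans/(_ za) h3 := ler_enorm1 (z - u *: a).
have /le_trans/(_ za) h4 := ler_enorm2 (z - u *: a).
have fin x y w : `|u * x - w| <= 2 * (N + 2)%:R -> `|w - u * y| <= 19 * N%:R ->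
    `|x - y| < r.
  move=> hx hy; rewrite -(ltr_pM2l u0) -[X in X * `|_|](gtr0_norm u0).
  rewrite -normrM mulrBr -(subrKA w); apply: le_lt_trans (ler_normD _ _) _.
  (* As [N] is at least 1, [2 * (N + 2)] is at most [6 * N], which adds to [19 * N]. *)
  apply: (@le_lt_trans _ _ (25 * N%:R)).
    by have := NR1; move: hx; rewrite natrD; lra.
  have -> : u * r = r * N%:R * N%:R by rewrite uE; ring.
  by rewrite ltr_pM2r.
by exists a => //; split; [apply: fin h1 h3|apply: fin h2 h4].
Qed.

(* The image of a chain point is within [19 / N] of [A]: [8 / N] for rationalizing
   the rotation, [8 / N] for the rescaling in [polygon], [2 / N] for rounding the
   translation and [1 / N] from [esc_le0_near].  The 3 x 3 block adds at most two
   cell sides, that is [6 / N]; hence the [25] in [Nr]. *)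
Lemma chain_placed (x y : nat -> nat) : grid_chain N x y ->
  (forall i, (i <= N)%N -> (x i <= 2 * N ^ 2)%N /\ (y i <= 2 * N ^ 2)%N) ->
  exists D0, forall D, (D0 <= D)%N -> chain_fits N B D s x y.
Proof.
move=> chain xy_le.
pose P i : R * R := ((x i)%:R, (y i)%:R).
have K0 : 0 < (N + 2)%:R :> R by rewrite ltr0n addn2.
have stepP i : (i < N)%N -> enorm (P i.+1 - P i) <= (N + 2)%:R.
  move=> iN; rewrite enorm_le ?ler0n//; have := chain i iN.
  by rewrite -(ler_nat R) natrD !natrX !adiffE !real_normK ?num_real.
have P_le i : (i <= N)%N -> enorm (P i) <= 4 * u.
  move=> iN; have [xi yi] := xy_le i iN; apply: le_trans (enorm_le_sum _) _.
  rewrite !ger0_norm//= (_ : 4 * u = (2 * N ^ 2)%:R + (2 * N ^ 2)%:R).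
    by rewrite lerD// ler_nat.
  by rewrite natrM -/u; ring.
have N10 : 0 < N%:R^-1 :> R by rewrite invr_gt0.
have [sg /Isomp_rigid[a [b [v [ab sgE]]]] near] :=
  esc_le0_near cA A0 escA (polygon_lip N0 K0 stepP) N10.
have [a1 [a2 [b1 [b2 [c [pl ha hb]]]]]] := rational_rotation ab N10.
have [X1 [X2 hX]] := nat_sub_approx (u * v.1).
have [Y1 [Y2 hY]] := nat_sub_approx (u * v.2).
have c0 : (0 < c)%N by case: pl.
have cR : c%:R != 0 :> R by rewrite pnatr_eq0 -lt0n.
set a' := _ / _ in ha; set b' := _ / _ in hb.
(* The translation is rounded to the grid and then moved by [H] strips, so that the cells used have
   natural indices. *)
apply: (chain_fits_intro (x1 := X1 + H * (N + 2)) (x2 := X2)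
  (y1 := Y1 + H * (N + 2)) (y2 := Y2) pl) => i iN.
have [|q Aq hq] := near (i%:R / N%:R).
  exact: mesh_itv.
move: hq; rewrite polygon_vertex// sgE dist2E => hq.
pose T : R * R := (X1%:R - X2%:R, Y1%:R - Y2%:R).
pose z := rotation a' b' (P i) + T.
have zq : enorm (z - u *: q) <= 19 * N%:R.
  pose k := ((N + 2)%:R * N%:R)^-1 : R.
  have -> : z - u *: q = rotation (a' - a) (b' - b) (P i) +
     ((1 - u * k) *: rotation a b (P i) + ((T - u *: v) +
       u *: (rotation a b (k *: P i) + v - q))).
    by rewrite /z; congr (_, _); rewrite /= /GRing.scale /=; ring.
  have -> : 19 * N%:R = 8 * N%:R + (8 * N%:R + (2 * N%:R + N%:R)) :> R by ring.
  apply: le_trans (ler_enormD _ _) _; apply: lerD.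
    rewrite enorm_rot_gen (_ : 8 * _ = 2 * N%:R^-1 * (4 * u)).
      apply: ler_pM; rewrite ?enorm_ge0 ?P_le//.
      by apply: le_trans (enorm_le_sum _) _ => /=; lra.
    by rewrite uE; field; rewrite gt_eqF.
  apply: le_trans (ler_enormD _ _) _; apply: lerD.
    rewrite enormZ enorm_rot// (_ : 8 * _ = 2 * N%:R^-1 * (4 * u)); last first.
      by rewrite uE; field; rewrite gt_eqF.
    apply: ler_pM; rewrite ?enorm_ge0 ?P_le//.
    (* The polygon is scaled by [1 / ((N + 2) * N)] where the grid has mesh [1 / N ^ 2]; this is the
       relative error. *)
    have -> : 1 - u * k = 2 / (N%:R + 2).
      rewrite /k uE natrD; field; rewrite gt_eqF//= gt_eqF//; lra.
    rewrite ger0_norm; last by rewrite divr_ge0//; lra.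
    by rewrite ler_pM2l// lef_pV2 ?posrE//; lra.
  apply: le_trans (ler_enormD _ _) _; apply: lerD.
    apply: le_trans (enorm_le_sum _) _; apply: le_trans (lerD hX hY) _.
    by have := NR1; lra.
  rewrite enormZ gtr0_norm//; apply: (@le_trans _ _ (u * N%:R^-1)).
    by rewrite ler_pM2l// ltW.
  by rewrite uE expr2 mulfK// gt_eqF.
have [q1 q2] := AM Aq.
have L1 : 1 <= (N + 2)%:R :> R by rewrite ler1n addn2.
have bound w t : `|t - 0| < M -> `|w - u * t| <= 19 * N%:R ->
    `|w| <= (H%:R - 2) * (N + 2)%:R.
  rewrite subr0 => tM hw; apply: (@le_trans _ _ (u * M + 19 * N%:R)).
    rewrite -[w](subrK (u * t)) addrC; apply: le_trans (ler_normD _ _) _.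
    by rewrite lerD// normrM gtr0_norm// ler_pM2l// ltW.
  apply: le_trans HM _; rewrite ler_peMr//; apply: le_trans HM.
  have := normr_ge0 t; have := NR0; have := u0; nra.
have Lpos : (0 < N + 2)%N by rewrite addn2.
have /(bound _ _ q1)/(strip_exists Lpos)[I IB hI] :=
  le_trans (ler_enorm1 (z - u *: q)) zq.
have /(bound _ _ q2)/(strip_exists Lpos)[J JB hJ] :=
  le_trans (ler_enorm2 (z - u *: q)) zq.
rewrite -Bdef in IB JB.
exists I; first by apply: leq_ltn_trans IB; exact: leq_addr.
exists J; first by apply: leq_ltn_trans JB; exact: leq_addr.
split; last exact: near_cell_block Aq IB JB hI hJ zq.
- apply/(@in_stripE R) => //.
  rewrite (_ : _ / c%:R = z.1 + H%:R * (N + 2)%:R)//.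
  by rewrite /z /T /= /a' /b' !(natrD, natrM); field.
- apply/(@in_stripE R) => //.
  rewrite (_ : _ / c%:R = z.2 + H%:R * (N + 2)%:R)//.
  by rewrite /z /T /= /a' /b' !(natrD, natrM); field.
Qed.

End Chain.
End Completeness.

(** * Certificates and the infimum of the areas *)

Section Main.
Variable R : realType.
Implicit Types A : set (R * R).

Lemma count_lt (v0 v1 v2 N c : nat) : (0 < N)%N ->
  (c * (N + 2) ^ 2 * v2.+1 + v1 * N ^ 4 < v0 * N ^ 4)%N =
  (c%:R * side R N ^+ 2 < (v0%:R - v1%:R) / v2.+1%:R).
Proof.
move=> N0; have n0 : 0 < N%:R :> R by rewrite ltr0n.
have v20 : 0 < v2.+1%:R :> R by rewrite ltr0n.
have -> : c%:R * side R N ^+ 2 = c%:R * (N + 2)%:R ^+ 2 / N%:R ^+ 4.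
  by rewrite /side natrX; field; rewrite gt_eqF.
rewrite ltr_pdivlMr// mulrAC ltr_pdivrMr ?exprn_gt0// mulrBl ltrBrDr.
by rewrite -(ltr_nat R) !(natrD, natrM, natrX); congr (_ < _); ring.
Qed.

Lemma certificate_complete A (v0 v1 v2 : nat) :
  compact A -> A !=set0 -> esc A (boundary A) 1 <= 0 ->
  (area A < ((v0%:R - v1%:R) / v2.+1%:R)%:E)%E ->
  exists N B D s, certificate v0 v1 v2 N B D s.
Proof.
move=> cA A0 escA /(area_box_nbhd cA)[r r0 Ar].
have [M M0 AM] := compact_box_bounded cA.
pose N := (Num.truncn (25 / r)).+1.
have Nr : 25 < r * N%:R by rewrite mulrC -ltr_pdivrMr// truncnS_gt.
pose H := (Num.truncn ((N ^ 2)%:R * M + 19 * N%:R + 2)).+1.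
have HM : (N ^ 2)%:R * M + 19 * N%:R <= H%:R - 2.
  by rewrite lerBrDr ltW// truncnS_gt.
(* [s] encodes exactly the cells contained in the neighbourhood, so their union has area below the
   given rational. *)
have [|s _ sd] := @digitsP 2 (H.*2 ^ 2) (fun k =>
    `[< half_open_cell N (H%:R : R) (k %/ H.*2) (k %% H.*2) `<=`
        box_nbhd A r >]).
  by move=> k _; case: asbool.
have sP k : (k < H.*2 ^ 2)%N -> half_open_cell N H%:R (k %/ H.*2) (k %% H.*2)
    `<=` box_nbhd A r -> digit 2 s k = 1%N.
  by move=> kB /asboolP sub; rewrite sd// sub.
have [|D hD] := @exists_bound_all (grid_size N ^ (2 * N.+1)) (fun e D =>
    grid_chain N (chain_x N e) (chain_y N e) ->
    chain_fits N H.*2 D s (chain_x N e) (chain_y N e)); last first.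
  exists N, H.*2, D, s; split=> //; last exact: hD.
  rewrite (count_lt _ _ _ _ (isT : (0 < N)%N)) -lte_fin.
  rewrite -(area_half_open_cells H%:R H.*2 s (isT : (0 < N)%N)).
  apply: le_lt_trans Ar; apply: le_measure; rewrite ?inE.
  - by apply: measurable_cell_union => *; exact: measurable_half_open_cell.
  - exact: measurable_box_nbhd.
  - move=> p /cell_unionP[k kB []]; rewrite sd//.
    by case: asboolP => // sub _ /sub.
move=> e _.
have [ch|nch] := pselect (grid_chain N (chain_x N e) (chain_y N e));
  last by exists 0%N.
have [|D0 hD0] :=
  chain_placed cA A0 escA (isT : (0 < N)%N) Nr AM HM erefl sP ch.
  move=> i _; have gN : (0 < grid_size N)%N by rewrite /grid_size addn1.
  have le k : (digit (grid_size N) e k <= 2 * N ^ 2)%N.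
    by rewrite -ltnS -[X in (_ < X)%N]addn1; exact: ltn_digit.
  by split; exact: le.
by exists D0 => D /hD0.
Qed.

Lemma compact_closed_cells N B s :
  compact (cell_union (closed_cell N) B s : set (R * R)).
Proof.
apply: bigsetU_compact => k _; case: ifP => _; last exact: compact0.
by apply: compact_setX; exact: segment_compact.
Qed.

(** Shows that the infimum is taken over a nonempty set: a path moved to start at the origin stays
    in the unit disc, hence in this square. *)
Lemma unit_square_admissible :
  [set A | [/\ compact A, A !=set0 & esc A (boundary A) 1 <= 0]]
    (`[-1, 1] `*` `[-1, 1] : set (R * R)).
Proof.
split.
- by apply: compact_setX; exact: segment_compact.
- by exists (0, 0); split; rewrite /= in_itv/= ler01 oppr_le0 ler01.
- apply: esc_le0 => f lipf.
  exists (fun p => p + (- f 0)); first exact: shift_Isomp.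
  move=> t t01; have := lipf t 0 t01; rewrite in_itv/= lexx ler01 => /(_ isT).
  rewrite mul1r subr0 dist2E => h.
  have {}h : enorm (f t - f 0) <= 1.
    apply: le_trans h _; move: t01; rewrite in_itv/= => /andP[t0 t1].
    by rewrite ger0_norm.
  by split; rewrite /= in_itv/= -ler_norml;
    [apply: le_trans (ler_enorm1 _) h|apply: le_trans (ler_enorm2 _) h].
Qed.

Lemma certificate_sound (v0 v1 v2 N B D s : nat) :
  certificate v0 v1 v2 N B D s ->
  inf [set fine (area A) | A in
    [set A : set (R * R) | [/\ compact A, A !=set0 & esc A (boundary A) 1 <= 0]]]
  < (v0%:R - v1%:R) / v2.+1%:R.
Proof.
move=> [N0 count fits]; rewrite (count_lt _ _ _ _ N0) in count.
have cover f := @all_chains_fit_cover R N B D s f N0 fits.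
set A := cell_union (closed_cell N) B s : set (R * R).
have cA : compact A by exact: compact_closed_cells.
have A0 : A !=set0.
  (* Covering a constant path already exhibits a point of [A]. *)
  have [|sg _ h] := cover (fun=> (0, 0)).
    by move=> t u _ _; rewrite dist2E subrr /enorm/= expr0n addr0 sqrtr0 mul1r.
  by exists (sg (0, 0)); apply: (h 0); rewrite in_itv/= lexx ler01.
apply: le_lt_trans count; apply: (@le_trans _ _ (fine (area A))).
  apply: ge_inf.
    by exists 0 => _ [A' _ <-]; rewrite fine_ge0// measure_ge0.
  exists A => //; split=> //; exact: esc_le0.
rewrite -lee_fin fineK ?area_compact_fin//.
exact: area_closed_cells.
Qed.

End Main.

Theorem theorem5p3 (R : realType) :
  right_ce (inf [set fine (area A) | A in
    [set A : set (R * R) | [/\ compact A, A !=set0 & esc A (boundary A) 1 <= 0]]]).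
Proof.
rewrite /right_ce /rat_comp_enumerable.
have [p hp] := enumerable_certificate; exists p => v; rewrite -hp /=.
have -> : ratr (rat_of_code v) =
    ((tnth v 0)%:R - (tnth v 1)%:R) / (tnth v 2%:R).+1%:R :> R.
  by rewrite /rat_of_code fmorph_div/= rmorphB/= !ratr_nat.
split=> [|[N [B [D [s]]]]]; last exact: certificate_sound.
(* A rational strictly above the infimum exceeds the area of some admissible [A], even if no
   minimizer is known. *)
move=> /inf_lt[|_ [A [cA A0 escA] <-] Aq].
  by exists (fine (area (`[-1, 1] `*` `[-1, 1] : set (R * R))));
    eexists; [exact: unit_square_admissible|].
apply: (certificate_complete cA A0 escA).
by rewrite -(fineK (area_compact_fin cA)) lte_fin.
Qed.
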